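(* The following statements are equivalent over $\mathrm{RCA}_0$: (i) $\mathrm{WKL}_0$. (ii) For every abelian group $G$ and every element $b\in G$, $b\neq 0$, there is a $k$-coloring of $G$ for which the equation $x-y=b$ has no monochromatic solutions, where $$k=\begin{cases}2 & \text{if } 2\mid \mathrm{ord}(b)\text{ or }\mathrm{ord}(b)=\infty,\\ 3 & \text{if }\mathrm{ord}(b)\text{ is odd.}\end{cases}$$
   Context: Statements are formalized in second-order arithmetic; $\mathrm{RCA}_0$ is the standard base system of reverse mathematics and $\mathrm{WKL}_0$ is $\mathrm{RCA}_0$ together with Weak König's Lemma (every infinite binary tree has an infinite path). Groups are countable groups coded in second-order arithmetic in the usual way, and $\mathrm{ord}(b)$ denotes the order of $b$ in $G$. A $k$-coloring of $G$ is a map $c:G\to k=\{0,\dots,k-1\}$. A monochromatic solution of $x-y=b$ is a pair $(x,y)\in G^2$ with $x-y=b$ and $c(x)=c(y)$. *)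

(* Defs.v *)
Set Implicit Arguments.
Unset Strict Implicit.
Unset Printing Implicit Defensive.

(** General (Henkin) structures: the number part may be nonstandard and [sets]
    is any domain for the set quantifiers, not the full power set.  As usual in
    this language, equality is primitive on numbers only. *)
Record L2structure : Type := {
  num : Type;
  sets : Type;
  mem : num -> sets -> Prop;
  zero : num;
  one : num;
  add : num -> num -> num;
  mul : num -> num -> num;
  lt : num -> num -> Prop;
  sets_inhabited : inhabited sets
}.

Arguments mem {_}.
Arguments zero {_}.
Arguments one {_}.
Arguments add {_}.
Arguments mul {_}.
Arguments lt {_}.

Declare Scope L2_scope.
Delimit Scope L2_scope with L2.
Bind Scope L2_scope with num.
Notation "0" := zero : L2_scope.
Notation "1" := one : L2_scope.
Notation "2" := (add one one) : L2_scope.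
Notation "3" := (add (add one one) one) : L2_scope.
Infix "+" := add : L2_scope.
Infix "*" := mul : L2_scope.
Infix "<" := lt : L2_scope.
Notation "x ∈ X" := (mem x X) (at level 70, no associativity) : L2_scope.
Local Open Scope L2_scope.

(** Number variables are de Bruijn indices.  Set variables are never bound, so
    they act as set parameters, named by natural numbers. *)
Inductive term : Set :=
| TVar (i : nat)
| TZero
| TOne
| TAdd (s t : term)
| TMul (s t : term).

Inductive bounded_formula : Set :=
| FEq (s t : term)
| FLt (s t : term)
| FMem (t : term) (X : nat)
| FNot (A : bounded_formula)
| FAnd (A B : bounded_formula)
| FOr (A B : bounded_formula)
| FImp (A B : bounded_formula)
| FAllLt (t : term) (A : bounded_formula)
| FExLt (t : term) (A : bounded_formula).

Definition scons (T : Type) (x : T) (e : nat -> T) (i : nat) : T :=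
  match i with O => x | S j => e j end.

Fixpoint eval (M : L2structure) (e : nat -> num M) (t : term) : num M :=
  match t with
  | TVar i => e i
  | TZero => 0
  | TOne => 1
  | TAdd s t => eval e s + eval e t
  | TMul s t => eval e s * eval e t
  end.

(** The bound of a bounded quantifier is evaluated outside of its scope. *)
Fixpoint holds (M : L2structure) (e : nat -> num M) (E : nat -> sets M)
    (A : bounded_formula) : Prop :=
  match A with
  | FEq s t => eval e s = eval e t
  | FLt s t => eval e s < eval e t
  | FMem t X => eval e t ∈ E X
  | FNot A => ~ holds e E A
  | FAnd A B => holds e E A /\ holds e E B
  | FOr A B => holds e E A \/ holds e E B
  | FImp A B => holds e E A -> holds e E B
  | FAllLt t A => forall x : num M, x < eval e t -> holds (scons x e) E A
  | FExLt t A => exists x : num M, x < eval e t /\ holds (scons x e) E A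
  end.

(** In the matrix [A], index 0 is the unbounded variable, index 1 is the
    argument [n], and the remaining variables are parameters. *)
Definition Sigma01 (M : L2structure) (e : nat -> num M) (E : nat -> sets M)
    (A : bounded_formula) (n : num M) : Prop :=
  exists m : num M, holds (scons m (scons n e)) E A.

Definition Pi01 (M : L2structure) (e : nat -> num M) (E : nat -> sets M)
    (A : bounded_formula) (n : num M) : Prop :=
  forall m : num M, holds (scons m (scons n e)) E A.

Record basic_axioms (M : L2structure) : Prop := {
  succ_neq_zero : forall n : num M, n + 1 <> 0;
  succ_inj : forall m n : num M, m + 1 = n + 1 -> m = n;
  add_zero : forall m : num M, m + 0 = m;
  add_succ : forall m n : num M, m + (n + 1) = (m + n) + 1;
  mul_zero : forall m : num M, m * 0 = 0;
  mul_succ : forall m n : num M, m * (n + 1) = m * n + m;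
  not_lt_zero : forall m : num M, ~ m < 0;
  lt_succ : forall m n : num M, m < n + 1 <-> m < n \/ m = n
}.

Definition Sigma01_induction (M : L2structure) : Prop :=
  forall (A : bounded_formula) (e : nat -> num M) (E : nat -> sets M),
    Sigma01 e E A 0 ->
    (forall n : num M, Sigma01 e E A n -> Sigma01 e E A (n + 1)) ->
    forall n : num M, Sigma01 e E A n.

Definition Delta01_comprehension (M : L2structure) : Prop :=
  forall (A B : bounded_formula) (e : nat -> num M) (E : nat -> sets M),
    (forall n : num M, Sigma01 e E A n <-> Pi01 e E B n) ->
    exists X : sets M, forall n : num M, n ∈ X <-> Sigma01 e E A n.

Record RCA0 (M : L2structure) : Prop := {
  RCA0_basic : basic_axioms M;
  RCA0_induction : Sigma01_induction M;
  RCA0_comprehension : Delta01_comprehension M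
}.

(** In the definitions below every quantifier ranges over [num M] or [sets M]
    (or a finite tuple of these), so [WKL] and [coloring_principle] are the
    interpretations in [M] of sentences of second-order arithmetic. *)

Definition pair (M : L2structure) (i j : num M) : num M :=
  (i + j) * (i + j) + i.

Definition prod_class (M : L2structure) (A B : num M -> Prop) (k : num M) : Prop :=
  exists i j : num M, A i /\ B j /\ k = pair i j.

Definition numbers (M : L2structure) (n : num M) : Prop := True.
Arguments numbers : clear implicits.

Definition elements (M : L2structure) (X : sets M) (n : num M) : Prop := n ∈ X.

Definition below (M : L2structure) (k n : num M) : Prop := n < k.

Definition maps (M : L2structure) (f : sets M) (i j : num M) : Prop :=
  pair i j ∈ f.

Definition is_function (M : L2structure) (A B : num M -> Prop) (f : sets M) : Prop :=
  (forall k : num M, k ∈ f -> prod_class A B k) /\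
  (forall i j j' : num M, maps f i j -> maps f i j' -> j = j') /\
  (forall i : num M, A i -> exists j : num M, B j /\ maps f i j).

(** The finite binary string σ is coded by the number whose binary expansion is
    1σ: the empty string is 1, appending the bit [i] to [s] gives [2 * s + i],
    and every number other than 0 codes exactly one string. *)
Definition is_string (M : L2structure) (s : num M) : Prop := s <> 0.

Definition power_of_two (M : L2structure) (p : num M) : Prop :=
  p <> 0 /\
  forall d q : num M, p = d * q -> d = 1 \/ exists h : num M, d = 2 * h.

(** [t] is [s] followed by a string of length log2 [p] with binary value [r]. *)
Definition initial_segment (M : L2structure) (s t : num M) : Prop :=
  exists p r : num M, power_of_two p /\ r < p /\ t = s * p + r.

Definition is_binary_tree (M : L2structure) (T : sets M) : Prop :=
  (forall s : num M, s ∈ T -> is_string s) /\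
  (forall s t : num M, is_string s -> initial_segment s t -> t ∈ T -> s ∈ T).

Definition infinite (M : L2structure) (X : sets M) : Prop :=
  forall m : num M, exists n : num M, m < n /\ n ∈ X.

(** [g] maps [n] to the code of the string f(0) ... f(n-1). *)
Definition is_restriction_map (M : L2structure) (f g : sets M) : Prop :=
  is_function (numbers M) (numbers M) g /\
  maps g 0 1 /\
  forall n s i : num M, maps g n s -> maps f n i -> maps g (n + 1) (2 * s + i).

Definition is_path (M : L2structure) (T f : sets M) : Prop :=
  is_function (numbers M) (below 2) f /\
  exists g : sets M, is_restriction_map f g /\
    forall n s : num M, maps g n s -> s ∈ T.

Definition WKL (M : L2structure) : Prop :=
  forall T : sets M, is_binary_tree T -> infinite T ->
  exists f : sets M, is_path T f.

Definition WKL0 (M : L2structure) : Prop := RCA0 M /\ WKL M.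

Record group_data (M : L2structure) : Type := {
  carrier : sets M;
  gadd : sets M;
  gopp : sets M;
  gzero : num M
}.

Definition in_group (M : L2structure) (G : group_data M) : num M -> Prop :=
  elements (carrier G).

Definition gsum (M : L2structure) (G : group_data M) (x y z : num M) : Prop :=
  maps (gadd G) (pair x y) z.

Definition gdiff (M : L2structure) (G : group_data M) (x y z : num M) : Prop :=
  exists y' : num M, maps (gopp G) y y' /\ gsum G x y' z.

Record is_abelian_group (M : L2structure) (G : group_data M) : Prop := {
  gadd_function :
    is_function (prod_class (in_group G) (in_group G)) (in_group G) (gadd G);
  gopp_function : is_function (in_group G) (in_group G) (gopp G);
  gzero_in : in_group G (gzero G);
  gadd_assoc : forall x y z u v w : num M,
    gsum G x y u -> gsum G y z v -> gsum G u z w -> gsum G x v w;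
  gadd_comm : forall x y z : num M, gsum G x y z -> gsum G y x z;
  gadd_zero : forall x : num M, in_group G x -> gsum G x (gzero G) x;
  gadd_opp : forall x y : num M, maps (gopp G) x y -> gsum G x y (gzero G)
}.

Definition is_multiples (M : L2structure) (G : group_data M) (b : num M)
    (f : sets M) : Prop :=
  is_function (numbers M) (in_group G) f /\
  maps f 0 (gzero G) /\
  forall n x y : num M, maps f n x -> gsum G x b y -> maps f (n + 1) y.

(** n b = x in [G]; [n] is a number of the model, possibly nonstandard. *)
Definition multiple (M : L2structure) (G : group_data M) (n b x : num M) : Prop :=
  exists f : sets M, is_multiples G b f /\ maps f n x.

Definition has_order (M : L2structure) (G : group_data M) (b n : num M) : Prop :=
  0 < n /\ multiple G n b (gzero G) /\
  forall m : num M, 0 < m -> m < n -> ~ multiple G m b (gzero G).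

Definition has_infinite_order (M : L2structure) (G : group_data M) (b : num M) : Prop :=
  forall n : num M, 0 < n -> ~ multiple G n b (gzero G).

Definition even_order (M : L2structure) (G : group_data M) (b : num M) : Prop :=
  exists n h : num M, has_order G b n /\ n = 2 * h.

Definition odd_order (M : L2structure) (G : group_data M) (b : num M) : Prop :=
  exists n h : num M, has_order G b n /\ n = 2 * h + 1.

Definition is_coloring (M : L2structure) (G : group_data M) (k : num M)
    (c : sets M) : Prop :=
  is_function (in_group G) (below k) c.

Definition monochromatic_solution (M : L2structure) (G : group_data M)
    (b : num M) (c : sets M) (x y : num M) : Prop :=
  in_group G x /\ in_group G y /\ gdiff G x y b /\
  exists i : num M, maps c x i /\ maps c y i.

Definition number_of_colors (M : L2structure) (G : group_data M) (b k : num M) : Prop :=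
  ((even_order G b \/ has_infinite_order G b) /\ k = 2) \/
  (odd_order G b /\ k = 3).

Definition coloring_principle (M : L2structure) : Prop :=
  forall (G : group_data M) (b : num M),
    is_abelian_group G -> in_group G b -> b <> gzero G ->
    exists k : num M, number_of_colors G b k /\
    exists c : sets M, is_coloring G k c /\
      forall x y : num M, ~ monochromatic_solution G b c x y.

(* Main.v *)
(** All arguments take place inside an arbitrary model of RCA0, with [x - y = b]
    viewed as a graph on [G] that joins [x] to [x + b].

    Colorings from WKL: if [b] has finite order, color [x] by the parity of
    the [j] below that order for which [x + j b] is least in its coset, using a
    third color at [j = 0] when the order is odd.  If [b] has infinite order, the
    binary strings that color an initial segment of [G] without conflict form a
    tree.  It is infinite because a string of every length exists that is
    consistent with the parity of all, possibly unbounded, multiples of [b]; this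
    is a Pi1 property and so is proved by Pi1 induction.

    WKL from colorings: given an infinite tree, a string [s] is enumerated at a
    certain stage when one of the subtrees above its two children has died out
    before the other, and a set that decides correctly which child survives for
    all enumerated [s] computes a path.  Let [G] be generated by [b] and [x_s],
    with [x_s] equal to a multiple of [b] when [s] is enumerated, the parity of the
    multiple recording the side that died.  In a 2-coloring the multiples of [b]
    alternate, so comparing the colors of [x_s] and 0 decides.  Since the
    multiples grow quickly with the stage, a relation between generators with
    small coefficients involves early stages only, so equality in [G] is
    decidable and [G] exists in the model. *)

From HB Require Import structures.
From mathcomp Require Import all_boot all_order all_algebra.
From mathcomp Require Import generic_quotient ring lra.
From mathcomp Require Import boolp.
Require Import Defs.

Set Implicit Arguments.
Unset Strict Implicit.
Unset Printing Implicit Defensive.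
Import Order.TTheory GRing.Theory Num.Theory.
Local Open Scope L2_scope.

(** * Definability in a model *)

(** The model may be nonstandard, with induction only for Sigma1 and Pi1 predicates and
    comprehension only for Delta1 ones, so each construction must come with a proof that its
    predicates lie in these classes. This is done by closure properties of predicates on
    environments; explicit formulas appear only at the bottom. The order of [b] decides how much is
    needed. With order [N], the coset of [x] is listed by the [x + j b] with [j < N], so its least
    member is found by bounded search and no compactness is used. With infinite order, lying in the
    same coset is only Sigma1, representatives cannot be chosen effectively, and the choice of a
    color in each coset is left to a path. Conversely, any 2-coloring must answer, for an element
    that may or may not turn out to be a multiple of [b], whether that multiple is even. This
    separates two disjoint Sigma1 sets, and such separation is the form in which weak König's lemma
    is recovered. In the group [b] has infinite order, so only two colors are ever available. *)

Fixpoint ren_term (r : nat -> nat) (t : term) : term :=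
  match t with
  | TVar i => TVar (r i)
  | TZero => TZero
  | TOne => TOne
  | TAdd s t => TAdd (ren_term r s) (ren_term r t)
  | TMul s t => TMul (ren_term r s) (ren_term r t)
  end.

Definition up (r : nat -> nat) (i : nat) : nat :=
  match i with O => O | S j => S (r j) end.

Fixpoint ren (r q : nat -> nat) (A : bounded_formula) : bounded_formula :=
  match A with
  | FEq s t => FEq (ren_term r s) (ren_term r t)
  | FLt s t => FLt (ren_term r s) (ren_term r t)
  | FMem t X => FMem (ren_term r t) (q X)
  | FNot A => FNot (ren r q A)
  | FAnd A B => FAnd (ren r q A) (ren r q B)
  | FOr A B => FOr (ren r q A) (ren r q B)
  | FImp A B => FImp (ren r q A) (ren r q B)
  | FAllLt t A => FAllLt (ren_term r t) (ren (up r) q A)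
  | FExLt t A => FExLt (ren_term r t) (ren (up r) q A)
  end.

Lemma eval_ren (M : L2structure) (r : nat -> nat) (e e' : nat -> num M) t :
  (forall i, e (r i) = e' i) -> eval e (ren_term r t) = eval e' t.
Proof. by move=> er; elim: t => //= s -> t ->. Qed.

Lemma holds_ren (M : L2structure) (q : nat -> nat) (E E' : nat -> sets M) A :
  (forall i, E (q i) = E' i) ->
  forall (r : nat -> nat) (e e' : nat -> num M), (forall i, e (r i) = e' i) ->
  holds e E (ren r q A) <-> holds e' E' A.
Proof.
move=> Eq; elim: A => /= [s t|s t|t X|A IH|A IA B IB|A IA B IB|A IA B IB
  |t A IH|t A IH] r e e' er; rewrite ?(eval_ren _ er) ?Eq //.
- by rewrite (IH _ _ _ er).
- by rewrite (IA _ _ _ er) (IB _ _ _ er).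
- by rewrite (IA _ _ _ er) (IB _ _ _ er).
- by rewrite (IA _ _ _ er) (IB _ _ _ er).
- have eru x i : scons x e (up r i) = scons x e' i by case: i => /=.
  by split=> h x xt; apply/(IH _ _ _ (eru x))/h.
- have eru x i : scons x e (up r i) = scons x e' i by case: i => /=.
  by split=> -[x [xt h]]; exists x; split=> //; apply/(IH _ _ _ (eru x)).
Qed.

(** Interleaving leaves room for infinitely many variables of both kinds, so no bound on the
    variables of a formula has to be tracked. *)
Definition mix (T : Type) (e c : nat -> T) (i : nat) : T :=
  if odd i then c i./2 else e i./2.

Lemma mix0 (T : Type) (e c : nat -> T) i : mix e c i.*2 = e i.
Proof. by rewrite /mix odd_double doubleK. Qed.

Lemma mix1 (T : Type) (e c : nat -> T) i : mix e c i.*2.+1 = c i.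
Proof. by rewrite /mix /= odd_double /= uphalf_double. Qed.

(** Moves the variable that reads as environment variable 0 to index 0 in front
    of the interleaved environment. *)
Definition bind (i : nat) : nat := if i is 0 then 0%N else if odd i then i.+1 else i.-1.

Lemma bind_mix (T : Type) x (e c : nat -> T) i :
  scons x (mix e c) (bind i) = mix (scons x e) c i.
Proof.
case: i => [|[|j]] //; rewrite /mix /= negbK; case: ifP => oj /=.
  by rewrite oj.
by rewrite oj.
Qed.

Section Definability.
Variable M : L2structure.
Implicit Types (P Q : (nat -> num M) -> Prop) (e c : nat -> num M).

(** The even variables of the formula read the environment, the odd ones its
    number parameters; a quantifier binds environment variable 0. *)
Definition definable0 P : Prop := exists A c E, forall e, P e <-> holds (mix e c) E A.

Definition definable_term (f : (nat -> num M) -> num M) : Prop :=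
  exists t c, forall e, f e = eval (mix e c) t.

Lemma term_var i : definable_term (fun e => e i).
Proof. by exists (TVar i.*2), (fun _ => 0) => e; rewrite /= mix0. Qed.

Lemma term_const a : definable_term (fun _ => a).
Proof. by exists (TVar 1), (fun _ => a). Qed.

(** Two formulas with parameters [c] and [d] are joined over the common parameters [mix c d]: [left]
    and [right] renumber the odd variables accordingly and fix the even ones. *)
Let left i := if odd i then (i./2).*2.*2.+1 else i.
Let right i := if odd i then (i./2).*2.+1.*2.+1 else i.

Let mix_left (T : Type) (e c d : nat -> T) i : mix e (mix c d) (left i) = mix e c i.
Proof.
rewrite /left; case oi: (odd i); first by rewrite mix1 mix0 /mix oi.
by rewrite /mix oi.
Qed.

Let mix_right (T : Type) (e c d : nat -> T) i : mix e (mix c d) (right i) = mix e d i.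
Proof.
rewrite /right; case oi: (odd i); first by rewrite !mix1 /mix oi.
by rewrite /mix oi.
Qed.

Let eval_left e c d t : eval (mix e (mix c d)) (ren_term left t) = eval (mix e c) t.
Proof. by apply: eval_ren => i; rewrite mix_left. Qed.

Let eval_right e c d t : eval (mix e (mix c d)) (ren_term right t) = eval (mix e d) t.
Proof. by apply: eval_ren => i; rewrite mix_right. Qed.

Let holds_left e c d E F A :
  holds (mix e (mix c d)) (mix E F) (ren left double A) <-> holds (mix e c) E A.
Proof. by apply: holds_ren => i; rewrite ?mix0 ?mix_left. Qed.

Let holds_right e c d E F A :
  holds (mix e (mix c d)) (mix E F) (ren right (fun i => i.*2.+1) A)
  <-> holds (mix e d) F A.
Proof. by apply: holds_ren => i; rewrite ?mix1 ?mix_right. Qed.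

Lemma term_add f g :
  definable_term f -> definable_term g -> definable_term (fun e => f e + g e).
Proof.
move=> [s [c fs]] [t [d gt]]; exists (TAdd (ren_term left s) (ren_term right t)).
by exists (mix c d) => e /=; rewrite eval_left eval_right fs gt.
Qed.

Lemma term_mul f g :
  definable_term f -> definable_term g -> definable_term (fun e => f e * g e).
Proof.
move=> [s [c fs]] [t [d gt]]; exists (TMul (ren_term left s) (ren_term right t)).
by exists (mix c d) => e /=; rewrite eval_left eval_right fs gt.
Qed.

Lemma definable0_eq f g :
  definable_term f -> definable_term g -> definable0 (fun e => f e = g e).
Proof.
move=> [s [c fs]] [t [d gt]]; have [X] := sets_inhabited M.
exists (FEq (ren_term left s) (ren_term right t)).
by exists (mix c d), (fun _ => X) => e /=; rewrite eval_left eval_right fs gt.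
Qed.

Lemma definable0_lt f g :
  definable_term f -> definable_term g -> definable0 (fun e => f e < g e).
Proof.
move=> [s [c fs]] [t [d gt]]; have [X] := sets_inhabited M.
exists (FLt (ren_term left s) (ren_term right t)).
by exists (mix c d), (fun _ => X) => e /=; rewrite eval_left eval_right fs gt.
Qed.

Lemma definable0_mem f X : definable_term f -> definable0 (fun e => f e ∈ X).
Proof.
by move=> [s [c fs]]; exists (FMem s 0), c, (fun _ => X) => e /=; rewrite fs.
Qed.

Lemma definable0_not P : definable0 P -> definable0 (fun e => ~ P e).
Proof. by move=> [A [c [E h]]]; exists (FNot A), c, E => e; rewrite h. Qed.

Lemma definable0_and P Q :
  definable0 P -> definable0 Q -> definable0 (fun e => P e /\ Q e).
Proof.
move=> [A [c [E h]]] [B [d [F k]]].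
exists (FAnd (ren left double A) (ren right (fun i => i.*2.+1) B)), (mix c d), (mix E F).
by move=> e; rewrite h k /= holds_left holds_right.
Qed.

Lemma definable0_or P Q :
  definable0 P -> definable0 Q -> definable0 (fun e => P e \/ Q e).
Proof.
move=> [A [c [E h]]] [B [d [F k]]].
exists (FOr (ren left double A) (ren right (fun i => i.*2.+1) B)), (mix c d), (mix E F).
by move=> e; rewrite h k /= holds_left holds_right.
Qed.

Lemma definable0_all_lt f (Q : (nat -> num M) -> num M -> Prop) :
  definable_term f -> definable0 (fun e => Q (fun i => e i.+1) (e 0%N)) ->
  definable0 (fun e => forall x, x < f e -> Q e x).
Proof.
move=> [s [c fs]] [A [d [F k]]].
exists (FAllLt (ren_term left s) (ren (fun i => bind (right i)) id A)), (mix c d), F => e /=.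
rewrite eval_left -fs; have h x : holds (scons x (mix e (mix c d))) F
    (ren (fun i => bind (right i)) id A) <-> Q e x.
  rewrite (k (scons x e)); apply: holds_ren => // i.
  by rewrite bind_mix mix_right.
by split=> H x xf; apply/h/H.
Qed.

Lemma definable0_ex_lt f (Q : (nat -> num M) -> num M -> Prop) :
  definable_term f -> definable0 (fun e => Q (fun i => e i.+1) (e 0%N)) ->
  definable0 (fun e => exists x, x < f e /\ Q e x).
Proof.
move=> [s [c fs]] [A [d [F k]]].
exists (FExLt (ren_term left s) (ren (fun i => bind (right i)) id A)), (mix c d), F => e /=.
rewrite eval_left -fs; have h x : holds (scons x (mix e (mix c d))) F
    (ren (fun i => bind (right i)) id A) <-> Q e x.
  rewrite (k (scons x e)); apply: holds_ren => // i.
  by rewrite bind_mix mix_right.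
by split=> -[x [xf H]]; exists x; split=> //; apply/h.
Qed.

Definition sigma1 P : Prop :=
  exists Q, definable0 Q /\ forall e, P e <-> exists m, Q (scons m e).

(** In [Sigma01] the witness and the argument stand in front of the interleaved environment; the
    renaming applies [bind] once for each of them. *)
Lemma holds_Sigma01 e0 c E A n m :
  holds (scons m (scons n (mix e0 c))) E (ren (fun i => up bind (bind i)) id A)
  <-> holds (mix (scons m (scons n e0)) c) E A.
Proof.
apply: holds_ren => // i; rewrite -bind_mix.
by case: (bind i) => //= j; rewrite bind_mix.
Qed.

Lemma sigma1_Sigma01 P e0 : sigma1 P ->
  exists A e E, forall n, P (scons n e0) <-> Sigma01 e E A n.
Proof.
move=> [Q [[A [c [E QA]]] PQ]].
exists (ren (fun i => up bind (bind i)) id A), (mix e0 c), E => n.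
by rewrite PQ; split=> -[m h]; exists m; move: h; rewrite QA holds_Sigma01.
Qed.

(** Delta1 comprehension takes two formulas over one common choice of parameters. *)
Lemma definable0_common P Q : definable0 P -> definable0 Q ->
  exists A B c E, forall e, (P e <-> holds (mix e c) E A) /\ (Q e <-> holds (mix e c) E B).
Proof.
move=> [A [c [E PA]]] [B [d [F QB]]].
exists (ren left double A), (ren right (fun i => i.*2.+1) B), (mix c d), (mix E F) => e.
by rewrite holds_left holds_right PA QB.
Qed.

Lemma definable0_ext P Q : (forall e, P e <-> Q e) -> definable0 P -> definable0 Q.
Proof. by move=> PQ [A [c [E h]]]; exists A, c, E => e; rewrite -PQ. Qed.

Lemma definable0_imp P Q :
  definable0 P -> definable0 Q -> definable0 (fun e => P e -> Q e).
Proof.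
move=> dP dQ; apply: (@definable0_ext (fun e => ~ P e \/ Q e)) => [e|].
  by rewrite implyE.
by apply: definable0_or => //; apply: definable0_not.
Qed.

Lemma term_comp f (s : nat -> nat) :
  definable_term f -> definable_term (fun e => f (fun i => e (s i))).
Proof.
move=> [t [c ft]]; exists (ren_term (fun i => if odd i then i else (s i./2).*2) t), c => e.
rewrite ft; apply/esym/eval_ren => i.
by rewrite {2}/mix; case: ifP => oi; [rewrite /mix oi | rewrite mix0].
Qed.

Lemma definable0_comp P (s : nat -> nat) :
  definable0 P -> definable0 (fun e => P (fun i => e (s i))).
Proof.
move=> [A [c [E h]]].
exists (ren (fun i => if odd i then i else (s i./2).*2) id A), c, E => e.
rewrite h; apply: iff_sym; apply: holds_ren => // i.
by rewrite {2}/mix; case: ifP => oi; [rewrite /mix oi | rewrite mix0].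
Qed.

Lemma definable0_sigma1 P : definable0 P -> sigma1 P.
Proof.
move=> dP; exists (fun e => P (fun i => e i.+1)); split; first exact: (definable0_comp succn).
by move=> e; split=> [Pe|[]] //; exists 0.
Qed.
End Definability.

Ltac definable_term :=
  lazymatch goal with
  | |- definable_term (fun _ => ?a) => exact: term_const
  | |- definable_term (fun e => e _) => exact: term_var
  | |- definable_term (fun e => add _ _) => apply: term_add; definable_term
  | |- definable_term (fun e => mul _ _) => apply: term_mul; definable_term
  end.

Ltac definable0 :=
  lazymatch goal with
  | |- definable0 (fun e => _ = _) => apply: definable0_eq; definable_term
  | |- definable0 (fun e => lt _ _) => apply: definable0_lt; definable_term
  | |- definable0 (fun e => Defs.mem _ _) => apply: definable0_mem; definable_term
  | |- definable0 (fun e => ~ _) => apply: definable0_not; definable0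
  | |- definable0 (fun e => _ /\ _) => apply: definable0_and; definable0
  | |- definable0 (fun e => _ \/ _) => apply: definable0_or; definable0
  | |- definable0 (fun e => forall x, lt x _ -> _) =>
      refine (definable0_all_lt (Q := fun _ _ => _) _ _); [definable_term | definable0]
  | |- definable0 (fun e => exists x, lt x _ /\ _) =>
      refine (definable0_ex_lt (Q := fun _ _ => _) _ _); [definable_term | definable0]
  | |- definable0 (fun e => _ -> _) => apply: definable0_imp; definable0
  end.

(** * Arithmetic in a model *)

Section Arithmetic.
Variables (M : L2structure) (H : RCA0 M).
Let B := RCA0_basic H.
Implicit Types x y z : num M.

Lemma induct1 (P : num M -> Prop) : sigma1 (fun e => P (e 0%N)) ->
  P 0 -> (forall n, P n -> P (n + 1)) -> forall n, P n.
Proof.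
move=> /(sigma1_Sigma01 (fun _ => 0)) [A [e [E PA]]] P0 PS n.
apply/(PA n)/(RCA0_induction H); first exact/PA.
by move=> k /PA Pk; apply/PA/PS.
Qed.

Lemma induct0 (P : num M -> Prop) : definable0 (fun e => P (e 0%N)) ->
  P 0 -> (forall n, P n -> P (n + 1)) -> forall n, P n.
Proof. by move=> dP; apply: induct1; apply: definable0_sigma1. Qed.

Lemma m_addA x y z : x + (y + z) = (x + y) + z.
Proof.
elim/induct0: z; first by definable0.
- by rewrite !(add_zero B).
- by move=> z IH; rewrite !(add_succ B) IH.
Qed.

Lemma m_add0 x : 0 + x = x.
Proof.
elim/induct0: x => [||x IH]; first by definable0.
- exact: add_zero.
- by rewrite (add_succ B) IH.
Qed.

Lemma m_addC x y : x + y = y + x.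
Proof.
elim/induct0: y; first by definable0.
  by rewrite (add_zero B) m_add0.
move=> y IH; rewrite (add_succ B) IH -(add_succ B) -!m_addA; congr (_ + _).
elim/induct0: x {IH} => [||x IH]; first by definable0.
  by rewrite (add_zero B) m_add0.
by rewrite (add_succ B) IH.
Qed.

Lemma m_mulDl x y z : (x + y) * z = x * z + y * z.
Proof.
elim/induct0: z => [||z IH]; first by definable0.
  by rewrite !(mul_zero B) m_add0.
rewrite !(mul_succ B) IH -!m_addA; congr (_ + _).
by rewrite !m_addA (m_addC x).
Qed.

Lemma m_mul0 x : 0 * x = 0.
Proof.
elim/induct0: x => [||x IH]; first by definable0.
  exact: mul_zero.
by rewrite (mul_succ B) IH m_add0.
Qed.

Lemma m_mul1 x : 1 * x = x.
Proof.
elim/induct0: x => [||x IH]; first by definable0.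
  exact: mul_zero.
by rewrite (mul_succ B) IH.
Qed.

Lemma m_mulC x y : x * y = y * x.
Proof.
elim/induct0: y => [||y IH]; first by definable0.
  by rewrite (mul_zero B) m_mul0.
by rewrite (mul_succ B) IH m_mulDl m_mul1.
Qed.

Lemma m_mulA x y z : x * (y * z) = (x * y) * z.
Proof.
elim/induct0: z => [||z IH]; first by definable0.
  by rewrite !(mul_zero B).
by rewrite !(mul_succ B) -IH m_mulC m_mulDl (m_mulC _ x) (m_mulC y x).
Qed.

Lemma m_addI x y z : x + z = y + z -> x = y.
Proof.
elim/induct0: z => [||z IH]; first by definable0.
  by rewrite !(add_zero B).
by rewrite !(add_succ B) => /(succ_inj B).
Qed.

Lemma m_lt_add x z : x < x + z + 1.
Proof.
elim/induct0: z => [||z IH]; first by definable0.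
  by apply/(lt_succ B); right; rewrite (add_zero B).
by apply/(lt_succ B); left; rewrite (add_succ B).
Qed.

Lemma m_ltP x y : x < y <-> exists z, y = x + z + 1.
Proof.
split=> [|[z ->]]; last exact: m_lt_add.
(* The bound on [z] turns the statement into a bounded formula, to which [induct0] applies. *)
suff: x < y -> exists z, z < y /\ y = x + z + 1.
  by move=> h /h [z [_ ->]]; exists z.
elim/induct0: y => [||y IH]; first by definable0.
  by move/(not_lt_zero B).
case/(lt_succ B) => [/IH [z [_ ->]]|->].
  exists (z + 1); split; last by rewrite !m_addA.
  by rewrite -(m_addA _ z) (m_addC x); exact: m_lt_add.
exists 0; rewrite (add_zero B); split=> //.
by have := m_lt_add 0 y; rewrite m_add0.
Qed.

Lemma m_zero_or_succ x : x = 0 \/ exists y, x = y + 1.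
Proof.
have : x = 0 \/ exists y, y < x /\ x = y + 1.
  elim/induct0: x => [||x IH]; [by definable0|by left|right].
  by exists x; split=> //; apply/(lt_succ B); right.
by move=> [|[y [_ ->]]]; [left|right; exists y].
Qed.

Lemma m_le_total x y : (exists z, x = y + z) \/ (exists z, y = x + z).
Proof.
suff : (exists z, z < x + 1 /\ x = y + z) \/ (exists z, z < y + 1 /\ y = x + z).
  by move=> [] [z [_ ->]]; [left|right]; exists z.
elim/induct0: y => [||y IH]; first by definable0.
  left; exists x; rewrite m_add0; split=> //; apply/(lt_succ B); by right.
have lt1 (u v : num M) : u < v + u + 1 by rewrite (m_addC v); exact: m_lt_add.
case: IH => -[z [_ ->]]; last first.
  by right; exists (z + 1); rewrite !m_addA; split=> //; rewrite -(m_addA x).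
case: (m_zero_or_succ z) => [->|[t ->]].
  right; exists 1; by rewrite (add_zero B); split.
left; exists t; split; last by rewrite -!m_addA (m_addC 1).
by rewrite (m_addC t) m_addA.
Qed.
End Arithmetic.


(** * The ordered ring of integers of a model *)

Definition model_nat (M : L2structure) (H : RCA0 M) : Type := num M.

Section Semiring.
Variables (M : L2structure) (H : RCA0 M).
(** The argument [H] of [model_nat] is a phantom that carries the axioms on which the algebraic
    instances depend. Equality is decided classically. *)
HB.instance Definition _ := gen_eqMixin (model_nat H).
HB.instance Definition _ := gen_choiceMixin (model_nat H).
HB.instance Definition _ :=
  GRing.isNmodule.Build (model_nat H) (m_addA H) (m_addC H) (m_add0 H).
HB.instance Definition _ := GRing.Nmodule_isComPzSemiRing.Build (model_nat H)
  (m_mulA H) (m_mulC H) (m_mul1 H) (m_mulDl H) (m_mul0 H).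
End Semiring.

Section Differences.
Variables (M : L2structure) (H : RCA0 M).
Local Open Scope ring_scope.
Local Open Scope quotient_scope.
Local Notation N := (model_nat H).
Implicit Types (x y z : N) (p q : N * N).

Let addN_inj x y z : y + x = z + x -> y = z.
Proof. exact: m_addI. Qed.

Definition same_difference p q : bool := p.1 + q.2 == q.1 + p.2.

Fact same_difference_equiv : equiv_class_of same_difference.
Proof.
split=> [p|p q|q p r]; rewrite /same_difference ?eqxx //.
move=> /eqP pq /eqP qr; apply/eqP/(@addN_inj q.2).
rewrite -addrA (addrC r.2) addrA pq addrAC qr; ring.
Qed.

Canonical same_difference_eq_rel := EquivRelPack same_difference_equiv.

(** Formal differences embed [num M] into an ordered domain, where [ring], [lra] and [nra] may
    subtract. *)
Definition model_int : Type := {eq_quot same_difference}.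
HB.instance Definition _ := Choice.on model_int.

Definition diff p : model_int := \pi_{eq_quot same_difference} p.

Lemma diff_eq p q : diff p = diff q <-> p.1 + q.2 = q.1 + p.2.
Proof. by split=> [/eqmodP/eqP|h]; last exact/eqmodP/eqP. Qed.

Definition parts (a : model_int) : N * N := repr (a : {eq_quot same_difference}).

Lemma partsK a : diff (parts a) = a.
Proof. exact: reprK. Qed.

Lemma diff_parts p : (parts (diff p)).1 + p.2 = p.1 + (parts (diff p)).2.
Proof. by apply/diff_eq; rewrite partsK. Qed.

Lemma diffP a : exists p, a = diff p.
Proof. by exists (parts a); rewrite partsK. Qed.

Definition int_add a b : model_int := diff ((parts a).1 + (parts b).1, (parts a).2 + (parts b).2).
Definition int_opp a : model_int := diff ((parts a).2, (parts a).1).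
Definition int_mul a b : model_int := diff
  ((parts a).1 * (parts b).1 + (parts a).2 * (parts b).2,
   (parts a).1 * (parts b).2 + (parts a).2 * (parts b).1).
Lemma int_addE p q : int_add (diff p) (diff q) = diff (p.1 + q.1, p.2 + q.2).
Proof.
apply/diff_eq => /=; move: (diff_parts p) (diff_parts q).
move: (parts (diff p)) (parts (diff q)) => p' q' hp hq.
rewrite addrACA hp hq; ring.
Qed.

Lemma int_oppE p : int_opp (diff p) = diff (p.2, p.1).
Proof. by apply/diff_eq => /=; rewrite addrC (addrC p.2) diff_parts. Qed.

Lemma int_mulE p q : int_mul (diff p) (diff q) =
  diff (p.1 * q.1 + p.2 * q.2, p.1 * q.2 + p.2 * q.1).
Proof.
apply/diff_eq => /=; move: (diff_parts p) (diff_parts q).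
case: (parts _) => a b; case: (parts _) => c d; case: p => p n; case: q => q m /= hp hq.
(* The representatives are changed one factor at a time; the two congruences are then added and the
   intermediate product is cancelled. *)
have left_cong : a * c + b * d + (p * d + n * c) = p * c + n * d + (a * d + b * c).
  have e1 : (a + n) * c = (p + b) * c by rewrite hp.
  have e2 : (p + b) * d = (a + n) * d by rewrite hp.
  by transitivity ((a + n) * c + (p + b) * d); [ring | rewrite e1 e2; ring].
have right_cong : p * c + n * d + (p * m + n * q) = p * q + n * m + (p * d + n * c).
  have e1 : p * (c + m) = p * (q + d) by rewrite hq.
  have e2 : n * (q + d) = n * (c + m) by rewrite hq.
  by transitivity (p * (c + m) + n * (q + d)); [ring | rewrite e1 e2; ring].
apply: (@addN_inj (p * c + n * d + (p * d + n * c))).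
rewrite addrACA [X in _ + X]addrC addrACA.
transitivity (a * c + b * d + (p * d + n * c) + (p * c + n * d + (p * m + n * q))); first ring.
by rewrite left_cong right_cong; ring.
Qed.

Fact int_addA : associative int_add.
Proof.
move=> a b c; have [p ->] := diffP a; have [q ->] := diffP b; have [r ->] := diffP c.
by rewrite !int_addE /= !addrA.
Qed.

Fact int_addC : commutative int_add.
Proof.
move=> a b; have [p ->] := diffP a; have [q ->] := diffP b.
by rewrite !int_addE addrC [X in (_, X)]addrC.
Qed.

Fact int_add0 : left_id (diff (0, 0)) int_add.
Proof. by move=> a; have [[x y] ->] := diffP a; rewrite int_addE /= !add0r. Qed.

Fact int_addN : left_inverse (diff (0, 0)) int_opp int_add.
Proof.
move=> a; have [p ->] := diffP a; rewrite int_oppE int_addE.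
by apply/diff_eq => /=; rewrite addr0 add0r addrC.
Qed.

HB.instance Definition _ :=
  GRing.isZmodule.Build model_int int_addA int_addC int_add0 int_addN.

Fact int_mulA : associative int_mul.
Proof.
move=> a b c; have [p ->] := diffP a; have [q ->] := diffP b; have [r ->] := diffP c.
by rewrite !int_mulE /=; congr (diff (_, _)); ring.
Qed.

Fact int_mulC : commutative int_mul.
Proof.
move=> a b; have [p ->] := diffP a; have [q ->] := diffP b.
by rewrite !int_mulE /=; congr (diff (_, _)); ring.
Qed.

Fact int_mul1 : left_id (diff (1, 0)) int_mul.
Proof.
move=> a; have [[x y] ->] := diffP a; rewrite int_mulE /=.
by congr (diff (_, _)); ring.
Qed.

Fact int_mulDl : left_distributive int_mul int_add.
Proof.
move=> a b c; have [p ->] := diffP a; have [q ->] := diffP b; have [r ->] := diffP c.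
by rewrite (int_addE p q) !int_mulE int_addE /=; congr (diff (_, _)); ring.
Qed.

Fact int_one_neq0 : diff (1, 0) != 0.
Proof.
apply/eqP => /diff_eq /=; rewrite !addr0 => e.
by apply: (@succ_neq_zero _ (RCA0_basic H) (0 : N)); rewrite m_add0.
Qed.

HB.instance Definition _ := GRing.Zmodule_isComNzRing.Build model_int
  int_mulA int_mulC int_mul1 int_mulDl int_one_neq0.

(** The hierarchy of integral domains includes an inverse operation; choosing an inverse classically
    wherever one exists supplies it. *)
Definition int_unit : {pred model_int} := fun a => `[< exists b : model_int, b * a = 1 >].
Definition int_inv (a : model_int) : model_int :=
  if pselect (exists b : model_int, b * a = 1) is left h then projT1 (cid h) else a.

Fact int_mulV : {in int_unit, left_inverse 1 int_inv *%R}.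
Proof.
move=> a /asboolP h; rewrite /int_inv; case: pselect => // h'.
by case: cid.
Qed.

Fact int_unitP a b : b * a = 1 -> int_unit a.
Proof. by move=> ba; apply/asboolP; exists b. Qed.

Fact int_inv_out : {in [predC int_unit], int_inv =1 id}.
Proof. by move=> a /asboolP h; rewrite /int_inv; case: pselect. Qed.

HB.instance Definition _ := GRing.ComNzRing_hasMulInverse.Build model_int
  int_mulV int_unitP int_inv_out.

Definition of_nat x : model_int := diff (x, 0).

Lemma of_natD x y : of_nat (x + y) = of_nat x + of_nat y.
Proof. by rewrite /of_nat -[RHS]/(int_add _ _) int_addE /= addr0. Qed.

Lemma of_natM x y : of_nat (x * y) = of_nat x * of_nat y.
Proof. by rewrite /of_nat -[RHS]/(int_mul _ _) int_mulE; congr (diff (_, _)) => /=; ring. Qed.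

Lemma of_nat_inj : injective of_nat.
Proof. by move=> x y /diff_eq /=; rewrite !addr0. Qed.

Lemma int_cases (a : model_int) : exists x, a = of_nat x \/ a = - of_nat x.
Proof.
have [[x y] ->] := diffP a.
have [[z /= ->]|[z /= ->]] := m_le_total H x y; exists z; [left|right].
  by apply/diff_eq => /=; rewrite addr0 addrC.
rewrite -[RHS]/(int_opp _) int_oppE; by apply/diff_eq => /=; rewrite add0r.
Qed.

Lemma of_nat0 : of_nat 0 = 0.
Proof. by []. Qed.

Lemma of_nat1 : of_nat 1 = 1.
Proof. by []. Qed.

Let add1_neq0 x : x + 1 <> 0.
Proof. exact: (@succ_neq_zero _ (RCA0_basic H)). Qed.

Let zero_or_succ x : x = 0 \/ exists y, x = y + 1.
Proof. exact: m_zero_or_succ. Qed.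

Let addN_eq0 x y : x + y = 0 -> x = 0 /\ y = 0.
Proof.
case: (zero_or_succ y) => [->|[z ->]]; first by rewrite addr0.
by rewrite addrA => /add1_neq0.
Qed.

Let mulN_eq0 x y : x * y = 0 -> x = 0 \/ y = 0.
Proof.
case: (zero_or_succ x) => [->|[u ->]]; first by left.
case: (zero_or_succ y) => [->|[v ->]]; first by right.
by rewrite mulrDr mulr1 addrA => /add1_neq0.
Qed.

Fact int_integral (a b : model_int) : a * b = 0 -> (a == 0) || (b == 0).
Proof.
have [x [->|->]] := int_cases a; have [y [->|->]] := int_cases b;
  rewrite ?mulrNN ?mulrN ?mulNr -?of_natM => /eqP; rewrite ?oppr_eq0 -of_nat0
  => /eqP /of_nat_inj /mulN_eq0 [] ->; rewrite ?oppr0 ?eqxx ?orbT //.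
Qed.

HB.instance Definition _ := GRing.ComUnitRing_isIntegral.Build model_int int_integral.

Definition int_le (a b : model_int) : bool := `[< exists x, b = a + of_nat x >].
Definition int_lt (a b : model_int) : bool := (b != a) && int_le a b.
Definition int_norm (a : model_int) : model_int := if int_le 0 a then a else - a.

Let le0P (a : model_int) : reflect (exists x, a = of_nat x) (int_le 0 a).
Proof. by apply: (iffP (asboolP _)) => -[x ->]; exists x; rewrite ?add0r. Qed.

Fact int_le0_add a b : int_le 0 a -> int_le 0 b -> int_le 0 (a + b).
Proof. by move=> /le0P [x ->] /le0P [y ->]; apply/le0P; exists (x + y); rewrite of_natD. Qed.

Fact int_le0_mul a b : int_le 0 a -> int_le 0 b -> int_le 0 (a * b).
Proof. by move=> /le0P [x ->] /le0P [y ->]; apply/le0P; exists (x * y); rewrite of_natM. Qed.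

Fact int_le0_anti a : int_le 0 a -> int_le a 0 -> a = 0.
Proof.
move=> /le0P [x ->] /asboolP [y]; rewrite -of_nat0 -of_natD => /of_nat_inj/esym.
by case/addN_eq0 => ->.
Qed.

Fact int_sub_ge0 a b : int_le 0 (b - a) = int_le a b.
Proof.
apply/le0P/asboolP => -[x e]; exists x; first by rewrite -e addrC subrK.
by rewrite e addrC addKr.
Qed.

Fact int_le0_total a : int_le 0 a || int_le a 0.
Proof.
have [x [->|->]] := int_cases a; apply/orP; [left|right].
  by apply/le0P; exists x.
by apply/asboolP; exists x; rewrite addNr.
Qed.

Fact int_normN a : int_norm (- a) = int_norm a.
Proof.
rewrite /int_norm; case: ifP => pN; case: ifP => p; rewrite ?opprK //.
  by rewrite (int_le0_anti p) ?oppr0 // -int_sub_ge0 sub0r.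
by have := int_le0_total a; rewrite p -int_sub_ge0 sub0r pN.
Qed.

Fact int_ge0_norm a : int_le 0 a -> int_norm a = a.
Proof. by rewrite /int_norm => ->. Qed.

HB.instance Definition _ := Num.IntegralDomain_isLeReal.Build model_int
  int_le0_add int_le0_mul int_le0_anti int_sub_ge0 int_le0_total int_normN
  int_ge0_norm (fun a b => erefl (int_lt a b)).

Lemma of_nat_ge0 x : 0 <= of_nat x.
Proof. by apply/le0P; exists x. Qed.

Lemma of_nat_le x y : (of_nat x <= of_nat y) <-> exists z, y = x + z.
Proof.
split=> [/asboolP [z]|[z ->]]; last by rewrite of_natD lerDl of_nat_ge0.
by rewrite -of_natD => /of_nat_inj ->; exists z.
Qed.

Lemma of_nat_lt x y : Defs.lt x y <-> of_nat x + 1 <= of_nat y.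
Proof.
rewrite (m_ltP H) -of_nat1 -of_natD of_nat_le.
by split=> -[z ->]; exists z; [exact: (addrAC x z 1) | exact: (addrAC x 1 z)].
Qed.
End Differences.


(** * Transfer of linear arithmetic from the integers to the model *)

Definition le (M : L2structure) (x y : num M) : Prop := x < y + 1.
Notation "x <= y" := (le x y) : L2_scope.

Section Transfer.
Variables (M : L2structure) (H : RCA0 M).
Local Notation "% x" := (@of_nat M H x) (at level 2).
Implicit Types x y : num M.

Lemma intD x y : %(x + y) = (%x + %y)%R. Proof. exact: of_natD. Qed.
Lemma intM x y : %(x * y) = (%x * %y)%R. Proof. exact: of_natM. Qed.
Lemma int0 : %0 = 0%R. Proof. exact: of_nat0. Qed.
Lemma int1 : %1 = 1%R. Proof. exact: of_nat1. Qed.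

Lemma int_eq x y : x = y <-> %x = %y.
Proof. by split=> [->|/of_nat_inj]. Qed.

(** Strict inequality becomes [+ 1 <=], so that procedures blind to the discreteness of the integers
    still see the gap. *)
Lemma int_ltE x y : x < y <-> (%x + 1 <= %y)%R.
Proof. exact: of_nat_lt. Qed.

Lemma int_leE x y : x <= y <-> (%x <= %y)%R.
Proof. by rewrite /le int_ltE intD int1 lerD2r. Qed.

Lemma int_geE x y : ~ x <= y <-> (%y + 1 <= %x)%R.
Proof.
rewrite -int_ltE int_leE (m_ltP H); split=> [|[z ->]].
  move=> nxy; have [] := m_le_total H x y => -[z xy].
    have [z0|[u zu]] := m_zero_or_succ H z.
      by case: nxy; rewrite xy z0 intD int0 addr0.
    by exists u; rewrite xy zu (m_addA H).
  by case: nxy; rewrite xy intD lerDl of_nat_ge0.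
rewrite !intD int1 => h.
have := of_nat_ge0 (z : model_nat H); lra.
Qed.

Lemma int_nlt x y : ~ x < y <-> (%y <= %x)%R.
Proof.
rewrite -int_leE; split=> [nxy|yx /int_ltE xy].
  by apply: contrapT => /int_geE; rewrite -int_ltE.
by move: yx xy => /int_leE; lra.
Qed.
End Transfer.

Ltac push_int H := rewrite ?(intD H, intM H, int0 H, int1 H).

(** Linear arithmetic in [M], by passing to its ordered ring of integers *)
Ltac to_int H :=
  try match goal with |- not _ => let h := fresh in intro h end;
  repeat match goal with
  | h : @eq (num _) _ _ |- _ => move/(int_eq H): h; push_int H => h
  | h : @Defs.lt _ _ _ |- _ => move/(int_ltE H): h; push_int H => h
  | h : @le _ _ _ |- _ => move/(int_leE H): h; push_int H => h
  | h : ~ @le _ _ _ |- _ => move/(int_geE H): h; push_int H => h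
  | h : ~ @Defs.lt _ _ _ |- _ => move/(int_nlt H): h; push_int H => h
  end;
  try match goal with
  | |- @eq (num _) _ _ => apply/(int_eq H)
  | |- @Defs.lt _ _ _ => apply/(int_ltE H)
  | |- @le _ _ _ => apply/(int_leE H)
  end;
  push_int H.

Ltac nonneg H t :=
  match t with
  | context [@of_nat _ H ?x] =>
      let T := type of (@of_nat_ge0 _ H x) in
      lazymatch goal with
      | _ : T |- _ => fail
      | _ => have := @of_nat_ge0 _ H x; let h := fresh "pos" in move=> h
      end
  end.

Ltac all_nonneg H :=
  repeat match goal with
  | h : ?t |- _ => nonneg H t
  | |- ?t => nonneg H t
  end.

Ltac clear_connectives :=
  repeat match goal with
  | h : not _ |- _ => clear h
  | h : _ \/ _ |- _ => clear h
  | h : _ /\ _ |- _ => clear h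
  | h : _ <-> _ |- _ => clear h
  end.

Ltac arith :=
  intros;
  lazymatch goal with
  | H : RCA0 _ |- _ => to_int H; clear_connectives; all_nonneg H; lra
  end.

Ltac narith :=
  intros;
  lazymatch goal with
  | H : RCA0 _ |- _ => to_int H; clear_connectives; all_nonneg H; nra
  end.


(** * Sigma1 and Delta1 predicates *)

Section Sigma1.
Variables (M : L2structure) (H : RCA0 M).
Implicit Types (P Q R : (nat -> num M) -> Prop) (e : nat -> num M).

Lemma eq_env R e e' : e =1 e' -> R e -> R e'.
Proof. by move=> /funext ->. Qed.

Lemma sigma1_comp P (s : nat -> nat) :
  sigma1 P -> sigma1 (fun e => P (fun i => e (s i))).
Proof.
move=> [R [dR PR]]; exists (fun e => R (fun i => e (up s i))).
split; first exact: definable0_comp.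
move=> e; rewrite PR; by split=> -[m h]; exists m; apply: eq_env h => -[].
Qed.

Lemma sigma1_ext P Q : (forall e, P e <-> Q e) -> sigma1 P -> sigma1 Q.
Proof. by move=> PQ [R [dR PR]]; exists R; split=> // e; rewrite -PQ. Qed.

(** The two nested witnesses are replaced by one number that bounds them both, so no pairing
    function is involved. *)
Lemma sigma1_ex (Q : (nat -> num M) -> num M -> Prop) :
  sigma1 (fun e => Q (fun i => e i.+1) (e 0%N)) -> sigma1 (fun e => exists x, Q e x).
Proof.
move=> [R [dR QR]].
exists (fun e => exists x, x < e 0%N /\ exists m, m < e 0%N /\
  R (scons m (scons x (fun i => e i.+1)))); split.
  apply: (definable0_ex_lt (Q := fun e x => exists m, m < e 0%N /\
    R (scons m (scons x (fun i => e i.+1))))) => /=; first exact: term_var.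
  apply: (definable0_ex_lt (Q := fun e m => R (scons m (scons (e 0%N) (fun i => e i.+2)))))
    => /=; first exact: term_var.
  have := definable0_comp (fun i => match i with 0 => 0 | 1 => 1 | i.+2 => i.+3 end)%N dR.
  apply: definable0_ext => e.
  by split=> h; apply: eq_env h => -[|[]].
move=> e; split=> [[x Qx]|[z [x [_ [m [_ Rm]]]]]]; last first.
  by exists x; apply/(QR (scons x e)); exists m.
have [m Rm] := (QR (scons x e)).1 Qx.
exists (x + m + 1) => /=; exists x; split; first arith.
by exists m; split=> //; arith.
Qed.

Lemma sigma1_and P Q : sigma1 P -> sigma1 Q -> sigma1 (fun e => P e /\ Q e).
Proof.
move=> [R [dR PR]] [S [dS QS]].
apply: (@sigma1_ext (fun e => exists x y, R (scons x e) /\ S (scons y e))) => [e|].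
  rewrite PR QS; split=> [[x [y [Rx Sy]]]|[[x Rx] [y Sy]]]; last by exists x, y.
  by split; [exists x|exists y].
apply: (sigma1_ex (Q := fun e x => exists y, R (scons x e) /\ S (scons y e))).
apply: (sigma1_ex (Q := fun e y => R (scons (e 0%N) (fun i => e i.+1)) /\
   S (scons y (fun i => e i.+1)))).
apply/definable0_sigma1/definable0_and.
  have := definable0_comp succn dR; apply: definable0_ext => e.
  by split=> h; apply: eq_env h => -[].
have := definable0_comp (fun i => match i with 0 => 0 | i.+1 => i.+2 end)%N dS.
apply: definable0_ext => e; by split=> h; apply: eq_env h => -[].
Qed.

Lemma sigma1_or P Q : sigma1 P -> sigma1 Q -> sigma1 (fun e => P e \/ Q e).
Proof.
move=> [R [dR PR]] [S [dS QS]]; exists (fun e => R e \/ S e).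
split=> [|e]; first exact: definable0_or.
rewrite PR QS; split=> [[] [m h]|[m [] h]]; [| |left|right]; exists m => //.
  by left.
by right.
Qed.

(** This is [Sigma01] collection: the existential witnesses for all [x < f e] are bounded. *)
Lemma sigma1_all_lt f (Q : (nat -> num M) -> num M -> Prop) : definable_term f ->
  sigma1 (fun e => Q (fun i => e i.+1) (e 0%N)) ->
  sigma1 (fun e => forall x, x < f e -> Q e x).
Proof.
move=> df [R [dR QR]].
have bounded g : definable_term g -> definable0 (fun e => forall x, x < g (fun i => e i.+1) ->
    exists m, m < e 0%N /\ R (scons m (scons x (fun i => e i.+1)))).
  move=> dg.
  apply: (definable0_all_lt (Q := fun e x => exists m, m < e 0%N /\
     R (scons m (scons x (fun i => e i.+1))))).
    exact: (term_comp succn).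
  apply: (definable0_ex_lt (Q := fun e m => R (scons m (scons (e 0%N) (fun i => e i.+2)))))
    => /=; first exact: term_var.
  have := definable0_comp (fun i => match i with 0 => 0 | 1 => 1 | i.+2 => i.+3 end)%N dR.
  apply: definable0_ext => e.
  by split=> h; apply: eq_env h => -[|[]].
eexists; split; first exact: (bounded f df).
move=> e /=; split=> [Qe|[b h] x /h [m [_ Rm]]]; last first.
  by apply/(QR (scons x e)); exists m.
(* The common bound is built by Sigma1 induction along the initial segments of [x < f e]. The
   premise keeps the segment inside the range where [Q] is known; it is decidable, so the
   implication becomes a Sigma1 disjunction. *)
pose P (e : nat -> num M) := e 0%N <= f (fun i => e i.+1) -> exists b, forall x, x < e 0%N ->
  exists m, m < b /\ R (scons m (scons x (fun i => e i.+1))).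
suff: forall n, P (scons n e).
  by move/(_ (f e)) => []; [arith|move=> b; exists b].
have sP : sigma1 P.
  apply: (@sigma1_ext (fun e => f (fun i => e i.+1) < e 0%N \/
    exists b, forall x, x < e 0%N -> exists m, m < b /\ R (scons m (scons x (fun i => e i.+1))))).
    move=> e'; rewrite /P implyE (_ : (f _ < _) = (~ e' 0%N <= f (fun i => e' i.+1))) //.
    apply/propext; split; arith.
  apply: sigma1_or.
    apply/definable0_sigma1/definable0_lt; last exact: term_var.
    exact: (term_comp succn).
  apply: (sigma1_ex (Q := fun e b => forall x, x < e 0%N -> exists m, m < b /\
     R (scons m (scons x (fun i => e i.+1))))).
  apply: definable0_sigma1.
  apply: (definable0_all_lt (Q := fun e x => exists m, m < e 0%N /\
     R (scons m (scons x (fun i => e i.+2))))); first exact: term_var.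
  apply: (definable0_ex_lt (Q := fun e m => R (scons m (scons (e 0%N) (fun i => e i.+3)))))
    => /=; first exact: term_var.
  have := definable0_comp (fun i => match i with 0 => 0 | 1 => 1 | i.+2 => i.+4 end)%N dR.
  apply: definable0_ext => e'.
  by split=> h; apply: eq_env h => -[|[]].
have [A [e' [E PA]]] := sigma1_Sigma01 e sP.
move=> n; apply/PA; apply: (RCA0_induction H); first apply/PA.
  by move=> _; exists 0 => x /=; arith.
move=> {}n /PA; rewrite /P /= => IH; apply/PA => /= nf.
case: IH => [|b hb]; first arith.
have [m Rm] : exists m, R (scons m (scons n e)).
  by apply/(QR (scons n e))/Qe; arith.
exists (b + m + 1) => x; rewrite (lt_succ (RCA0_basic H)) => -[/hb [m' [m'b Rm']]|->].
  by exists m'; split=> //; arith.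
by exists m; split=> //; arith.
Qed.
End Sigma1.

Section Delta1.
Variables (M : L2structure) (H : RCA0 M).
Implicit Types (P Q : (nat -> num M) -> Prop) (e : nat -> num M).
Implicit Types (f g h : (nat -> num M) -> num M).

Definition delta1 P : Prop := sigma1 P /\ sigma1 (fun e => ~ P e).

(** For a total function a Sigma1 graph is automatically Delta1: a number is not the value when some
    other number is. *)
Definition recursive f : Prop := sigma1 (fun e => e 0%N = f (fun i => e i.+1)).

Definition rec1 (f : num M -> num M) := recursive (fun e => f (e 0%N)).
Definition rec2 (f : num M -> num M -> num M) := recursive (fun e => f (e 0%N) (e 1%N)).
Definition rec3 (f : num M -> num M -> num M -> num M) :=
  recursive (fun e => f (e 0%N) (e 1%N) (e 2%N)).
Definition rel1 (R : num M -> Prop) := delta1 (fun e => R (e 0%N)).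
Definition rel2 (R : num M -> num M -> Prop) := delta1 (fun e => R (e 0%N) (e 1%N)).
Definition rel3 (R : num M -> num M -> num M -> Prop) :=
  delta1 (fun e => R (e 0%N) (e 1%N) (e 2%N)).

Lemma delta1_ext P Q : (forall e, P e <-> Q e) -> delta1 P -> delta1 Q.
Proof.
move=> PQ [P1 P2]; split; first exact: sigma1_ext P1.
by apply: sigma1_ext P2 => e; rewrite PQ.
Qed.

Lemma delta1_sigma1 P : delta1 P -> sigma1 P.
Proof. by case. Qed.

Lemma definable0_delta1 P : definable0 P -> delta1 P.
Proof. by move=> dP; split; apply/definable0_sigma1 => //; apply: definable0_not. Qed.

Lemma term_recursive f : definable_term f -> recursive f.
Proof.
move=> df; apply/definable0_sigma1/definable0_eq; first exact: term_var.
exact: (term_comp succn).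
Qed.

(** The value of [f] is introduced by an existential quantifier. As [f] is total, the complement has
    the same form, which gives [delta1_app]. *)
Lemma sigma1_app f (Q : (nat -> num M) -> num M -> Prop) : recursive f ->
  sigma1 (fun e => Q (fun i => e i.+1) (e 0%N)) -> sigma1 (fun e => Q e (f e)).
Proof.
move=> rf sQ; apply: (@sigma1_ext _ (fun e => exists x, x = f e /\ Q e x)) => [e|].
  by split=> [[x [-> ]]|] //; exists (f e).
by apply: (sigma1_ex H (Q := fun e x => x = f e /\ Q e x)); apply: sigma1_and.
Qed.

Lemma delta1_app f (Q : (nat -> num M) -> num M -> Prop) : recursive f ->
  delta1 (fun e => Q (fun i => e i.+1) (e 0%N)) -> delta1 (fun e => Q e (f e)).
Proof.
move=> rf [Q1 Q2]; split; first exact: sigma1_app.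
exact: (sigma1_app (Q := fun e x => ~ Q e x)).
Qed.

Lemma recursive_app f (g : (nat -> num M) -> num M -> num M) : recursive f ->
  recursive (fun e => g (fun i => e i.+1) (e 0%N)) -> recursive (fun e => g e (f e)).
Proof.
move=> rf rg; apply: (sigma1_app (f := fun e => f (fun i => e i.+1))
  (Q := fun e x => e 0%N = g (fun i => e i.+1) x)).
  exact: (sigma1_comp (fun i => match i with 0 => 0 | i.+1 => i.+2 end)%N rf).
exact: (sigma1_comp (fun i => match i with 0 => 1 | 1 => 0 | i => i end)%N rg).
Qed.

Lemma delta1_comp P (s : nat -> nat) :
  delta1 P -> delta1 (fun e => P (fun i => e (s i))).
Proof. by move=> [P1 P2]; split; [exact: sigma1_comp | exact: (sigma1_comp s P2)]. Qed.

Lemma recursive_comp f (s : nat -> nat) :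
  recursive f -> recursive (fun e => f (fun i => e (s i))).
Proof. by move=> rf; apply: (sigma1_comp (up s) rf). Qed.

Lemma rel1_app R f : rel1 R -> recursive f -> delta1 (fun e => R (f e)).
Proof.
move=> rR rf; apply: (delta1_app (Q := fun e x => R x)) rf _.
exact: (delta1_comp id rR).
Qed.

Lemma rel2_app R f g :
  rel2 R -> recursive f -> recursive g -> delta1 (fun e => R (f e) (g e)).
Proof.
move=> rR rf rg; apply: (delta1_app (Q := fun e x => R x (g e)) rf).
apply: (delta1_app (f := fun e => g (fun i => e i.+1)) (Q := fun e x => R (e 0%N) x)).
  exact: recursive_comp.
exact: (delta1_comp (fun i => match i with 0 => 1 | 1 => 0 | i => i end)%N rR).
Qed.

Lemma rel3_app R f g h : rel3 R -> recursive f -> recursive g -> recursive h ->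
  delta1 (fun e => R (f e) (g e) (h e)).
Proof.
move=> rR rf rg rh; apply: (delta1_app (Q := fun e x => R x (g e) (h e)) rf).
apply: (delta1_app (f := fun e => g (fun i => e i.+1))
  (Q := fun e x => R (e 0%N) x (h (fun i => e i.+1)))); first exact: recursive_comp.
apply: (delta1_app (f := fun e => h (fun i => e i.+2)) (Q := fun e x => R (e 1%N) (e 0%N) x)).
  exact: (recursive_comp (fun i => i.+2)).
exact: (delta1_comp (fun i => match i with 0 => 2 | 1 => 1 | 2 => 0 | i => i end)%N rR).
Qed.

Lemma rec1_app k f : rec1 k -> recursive f -> recursive (fun e => k (f e)).
Proof.
move=> rk rf; apply: (recursive_app (g := fun e x => k x)) rf _.
exact: (recursive_comp id rk).
Qed.

Lemma rec2_app k f g :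
  rec2 k -> recursive f -> recursive g -> recursive (fun e => k (f e) (g e)).
Proof.
move=> rk rf rg; apply: (recursive_app (g := fun e x => k x (g e)) rf).
apply: (recursive_app (f := fun e => g (fun i => e i.+1)) (g := fun e x => k (e 0%N) x)).
  exact: recursive_comp.
exact: (recursive_comp (fun i => match i with 0 => 1 | 1 => 0 | i => i end)%N rk).
Qed.

Lemma rec3_app k f g h : rec3 k -> recursive f -> recursive g -> recursive h ->
  recursive (fun e => k (f e) (g e) (h e)).
Proof.
move=> rk rf rg rh; apply: (recursive_app (g := fun e x => k x (g e) (h e)) rf).
apply: (recursive_app (f := fun e => g (fun i => e i.+1))
  (g := fun e x => k (e 0%N) x (h (fun i => e i.+1)))); first exact: recursive_comp.
apply: (recursive_app (f := fun e => h (fun i => e i.+2)) (g := fun e x => k (e 1%N) (e 0%N) x)).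
  exact: (recursive_comp (fun i => i.+2)).
exact: (recursive_comp (fun i => match i with 0 => 2 | 1 => 1 | 2 => 0 | i => i end)%N rk).
Qed.

Lemma recursive_var i : recursive (fun e => e i).
Proof. exact/term_recursive/term_var. Qed.

Lemma recursive_const a : recursive (fun _ => a).
Proof. exact/term_recursive/term_const. Qed.

Lemma delta1_const (A : Prop) : delta1 (fun _ => A).
Proof.
have t : definable0 (fun e : nat -> num M => e 0%N = e 0%N) by definable0.
have f : definable0 (fun e : nat -> num M => ~ (e 0%N = e 0%N)) by definable0.
case: (pselect A) => a; apply: definable0_delta1; [apply: definable0_ext t|
  apply: definable0_ext f] => e; tauto.
Qed.

Lemma rec2_add : rec2 (@add M).
Proof. by apply: term_recursive; definable_term. Qed.

Lemma rec2_mul : rec2 (@mul M).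
Proof. by apply: term_recursive; definable_term. Qed.

Lemma rec2_pair : rec2 (@pair M).
Proof. by apply: term_recursive; rewrite /pair; definable_term. Qed.

Lemma rel2_eq : rel2 (@eq (num M)).
Proof. by apply: definable0_delta1; definable0. Qed.

Lemma rel2_lt : rel2 (@Defs.lt M).
Proof. by apply: definable0_delta1; definable0. Qed.

Lemma rel2_le : rel2 (@le M).
Proof. by apply: definable0_delta1; rewrite /le; definable0. Qed.

Lemma rel1_mem X : rel1 (fun n : num M => n ∈ X).
Proof. by apply: definable0_delta1; definable0. Qed.

Lemma delta1_not P : delta1 P -> delta1 (fun e => ~ P e).
Proof. by move=> [P1 P2]; split=> //; apply: sigma1_ext P1 => e; rewrite notK. Qed.

Lemma delta1_and P Q : delta1 P -> delta1 Q -> delta1 (fun e => P e /\ Q e).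
Proof.
move=> [P1 P2] [Q1 Q2]; split; first exact: sigma1_and.
by apply: sigma1_ext (sigma1_or P2 Q2) => e; rewrite not_andE.
Qed.

Lemma delta1_or P Q : delta1 P -> delta1 Q -> delta1 (fun e => P e \/ Q e).
Proof.
move=> [P1 P2] [Q1 Q2]; split; first exact: sigma1_or.
by apply: sigma1_ext (sigma1_and H P2 Q2) => e; rewrite not_orE.
Qed.

Lemma delta1_imp P Q : delta1 P -> delta1 Q -> delta1 (fun e => P e -> Q e).
Proof.
move=> dP dQ; apply: delta1_ext (delta1_or (delta1_not dP) dQ) => e.
by rewrite implyE.
Qed.

Lemma delta1_iff P Q : delta1 P -> delta1 Q -> delta1 (fun e => P e <-> Q e).
Proof. by move=> dP dQ; apply: delta1_and; apply: delta1_imp. Qed.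

Lemma sigma1_bounded_all f (Q : (nat -> num M) -> num M -> Prop) : recursive f ->
  sigma1 (fun e => Q (fun i => e i.+1) (e 0%N)) ->
  sigma1 (fun e => forall x, x < f e -> Q e x).
Proof.
move=> rf sQ; apply: (sigma1_app (Q := fun e y => forall x, x < y -> Q e x) rf).
apply: (sigma1_all_lt H (Q := fun e x => Q (fun i => e i.+1) x)); first exact: term_var.
exact: (sigma1_comp (fun i => match i with 0 => 0 | i.+1 => i.+2 end)%N sQ).
Qed.

Lemma delta1_all_lt f (Q : (nat -> num M) -> num M -> Prop) : recursive f ->
  delta1 (fun e => Q (fun i => e i.+1) (e 0%N)) ->
  delta1 (fun e => forall x, x < f e -> Q e x).
Proof.
move=> rf [Q1 Q2]; split; first exact: sigma1_bounded_all.
apply: (@sigma1_ext _ (fun e => exists x, x < f e /\ ~ Q e x)) => [e|].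
  by split=> [[x [xf nQ]] h|/existsNP [x /not_implyP [xf nQ]]]; [exact: nQ (h x xf)|exists x].
apply: (sigma1_ex H (Q := fun e x => x < f e /\ ~ Q e x)); apply: (sigma1_and H) => //.
apply: delta1_sigma1; apply: (rel2_app rel2_lt); first exact: recursive_var.
exact: recursive_comp.
Qed.

Lemma delta1_ex_lt f (Q : (nat -> num M) -> num M -> Prop) : recursive f ->
  delta1 (fun e => Q (fun i => e i.+1) (e 0%N)) ->
  delta1 (fun e => exists x, x < f e /\ Q e x).
Proof.
move=> rf dQ.
have := delta1_not (delta1_all_lt (Q := fun e x => ~ Q e x) rf (delta1_not dQ)).
apply: delta1_ext => e; split=> [/existsNP [x /not_implyP [xf /contrapT Qx]]|[x [xf Qx]] h].
  by exists x.
exact: h x xf Qx.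
Qed.

Lemma delta1_all_le f (Q : (nat -> num M) -> num M -> Prop) : recursive f ->
  delta1 (fun e => Q (fun i => e i.+1) (e 0%N)) ->
  delta1 (fun e => forall x, x <= f e -> Q e x).
Proof.
move=> rf; apply: (delta1_all_lt (f := fun e => f e + 1)).
by apply: (rec2_app rec2_add) rf _; exact: recursive_const.
Qed.

Lemma delta1_ex_le f (Q : (nat -> num M) -> num M -> Prop) : recursive f ->
  delta1 (fun e => Q (fun i => e i.+1) (e 0%N)) ->
  delta1 (fun e => exists x, x <= f e /\ Q e x).
Proof.
move=> rf; apply: (delta1_ex_lt (f := fun e => f e + 1)).
by apply: (rec2_app rec2_add) rf _; exact: recursive_const.
Qed.

Lemma comprehension (P : num M -> Prop) :
  rel1 P -> exists X : sets M, forall n, n ∈ X <-> P n.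
Proof.
move=> [[Q1 [d1 PQ1]] [Q2 [d2 PQ2]]].
have [A [B [c [E AB]]]] := definable0_common d1 d2.
pose s := ren (fun i => up bind (bind i)) id.
have eA (n : num M) : P n <-> Sigma01 (mix (fun _ => 0) c) E (s A) n.
  rewrite (PQ1 (scons n (fun _ => 0))).
  by split=> -[m h]; exists m; move: h; rewrite (AB _).1 holds_Sigma01.
have eB (n : num M) : P n <-> Pi01 (mix (fun _ => 0) c) E (FNot (s B)) n.
  rewrite -[P n]notK (PQ2 (scons n (fun _ => 0))).
  rewrite -forallNE; split=> h m; move: (h m);
    by rewrite (AB _).2 /= holds_Sigma01.
have [n|X hX] := @RCA0_comprehension _ H (s A) (FNot (s B)) (mix (fun _ => 0) c) E.
  by rewrite -eA -eB.
by exists X => n; rewrite hX -eA.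
Qed.
End Delta1.

Create HintDb definability discriminated.
#[global] Hint Constants Opaque : definability.
#[global] Hint Resolve rec2_add rec2_mul rec2_pair : definability.
#[global] Hint Resolve rel2_eq rel2_lt rel2_le rel1_mem : definability.

Ltac definable_hint := solve [assumption | eauto 3 with definability nocore].

(** The alternatives under [first] serve predicates and functions whose leading arguments are
    parameters independent of the environment. *)
Ltac definable :=
  cbv beta;
  lazymatch goal with
  | H : RCA0 _ |- sigma1 _ =>
    lazymatch goal with
    | |- sigma1 (fun e => exists x, _) => apply: (sigma1_ex H); definable
    | |- sigma1 (fun e => _ /\ _) => apply: (sigma1_and H); definable
    | |- sigma1 (fun e => _ \/ _) => apply: sigma1_or; definable
    | |- sigma1 (fun e => forall x, lt x _ -> _) => apply: (sigma1_bounded_all H); definable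
    | |- _ => apply: delta1_sigma1; definable
    end
  | H : RCA0 _ |- delta1 _ =>
    lazymatch goal with
    | |- delta1 (fun _ => ?A) => apply: delta1_const
    | |- delta1 (fun e => ~ _) => apply: delta1_not; definable
    | |- delta1 (fun e => _ /\ _) => apply: (delta1_and H); definable
    | |- delta1 (fun e => _ \/ _) => apply: (delta1_or H); definable
    | |- delta1 (fun e => _ <-> _) => apply: (delta1_iff H); definable
    | |- delta1 (fun e => forall x, lt x _ -> _) => apply: (delta1_all_lt H); definable
    | |- delta1 (fun e => forall x, le x _ -> _) => apply: (delta1_all_le H); definable
    | |- delta1 (fun e => exists x, lt x _ /\ _) => apply: (delta1_ex_lt H); definable
    | |- delta1 (fun e => exists x, le x _ /\ _) => apply: (delta1_ex_le H); definable
    | |- delta1 (fun e => _ -> _) => apply: (delta1_imp H); definable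
    | |- delta1 (fun e => @Defs.mem _ (@?a e) ?X) =>
        apply: (rel1_app H (R := fun n => @Defs.mem _ n X)); [definable_hint | definable]
    | |- delta1 (fun e => ?R (@?a e) (@?b e) (@?c e)) =>
      first [ apply: (rel3_app H (R := R)); [definable_hint | definable ..]
            | apply: (rel2_app H (R := R _)); [definable_hint | definable ..]
            | apply: (rel1_app H (R := R _ _)); [definable_hint | definable ..] ]
    | |- delta1 (fun e => ?R (@?a e) (@?b e)) =>
      first [ apply: (rel2_app H (R := R)); [definable_hint | definable ..]
            | apply: (rel1_app H (R := R _)); [definable_hint | definable ..] ]
    | |- delta1 (fun e => ?R (@?a e)) =>
        apply: (rel1_app H (R := R)); [definable_hint | definable ..]
    end
  | H : RCA0 _ |- recursive _ =>
    lazymatch goal with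
    | |- recursive (fun _ => ?a) => apply: recursive_const
    | |- recursive (fun e => e _) => apply: recursive_var
    | |- recursive (fun e => ?R (@?a e) (@?b e) (@?c e)) =>
      first [ apply: (rec3_app H (k := R)); [definable_hint | definable ..]
            | apply: (rec2_app H (k := R _)); [definable_hint | definable ..]
            | apply: (rec1_app H (k := R _ _)); [definable_hint | definable ..] ]
    | |- recursive (fun e => ?R (@?a e) (@?b e)) =>
      first [ apply: (rec2_app H (k := R)); [definable_hint | definable ..]
            | apply: (rec1_app H (k := R _)); [definable_hint | definable ..] ]
    | |- recursive (fun e => ?R (@?a e)) =>
        apply: (rec1_app H (k := R)); [definable_hint | definable ..]
    end
  end.

(** * Pi1 induction, strong induction and least numbers *)

Section Induction.
Variables (M : L2structure) (H : RCA0 M).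
Implicit Types x y z : num M.

(** Sigma1 induction is run downwards: a failure at [a] yields a failure at [a - x] for each [x] up
    to [a], and finally one at 0. *)
Lemma pi1_induction (P : num M -> Prop) : sigma1 (fun e => ~ P (e 0%N)) ->
  P 0 -> (forall n, P n -> P (n + 1)) -> forall n, P n.
Proof.
move=> sP P0 PS a; apply: contrapT => nPa.
suff: forall x, exists y, y + x = a /\ ~ P y \/ a < x.
  move=> /(_ a) [y [[ya nP]|]]; last arith.
  by apply: nP; rewrite (_ : y = 0) //; arith.
apply: (induct1 H).
- apply: (sigma1_ex H); apply: sigma1_or; last definable.
  apply: (sigma1_and H); first definable.
  exact: (sigma1_comp id sP).
- by exists a; left; split=> //; arith.
- move=> x [y [[yx nPy]|ax]]; last by exists 0; right; arith.
  have [y0|[z yz]] := m_zero_or_succ H y; first by case: nPy; rewrite y0.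
  exists z; left; split; first arith.
  by move=> /PS; rewrite -yz.
Qed.

Lemma strong_induction (P : num M -> Prop) : sigma1 (fun e => P (e 0%N)) ->
  (forall n, (forall k, k < n -> P k) -> P n) -> forall n, P n.
Proof.
move=> sP PS n; suff h : forall m, forall k, k < m -> P k by apply: (h (n + 1)); arith.
apply: (induct1 H).
- apply: (sigma1_bounded_all H); first definable.
  exact: (sigma1_comp id sP).
- by move=> k /(not_lt_zero (RCA0_basic H)).
- by move=> m IH k /(lt_succ (RCA0_basic H)) [/IH|->] //; apply: PS.
Qed.

Lemma least (P : num M -> Prop) : rel1 P -> (exists n, P n) ->
  exists n, P n /\ forall k, k < n -> ~ P k.
Proof.
move=> dP [n Pn]; apply: contrapT => no.
suff: forall n, ~ P n by move/(_ n).
apply: strong_induction; first exact: (delta1_not dP).1.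
by move=> m hm Pm; apply: no; exists m.
Qed.

Lemma lt_irrefl x : ~ x < x. Proof. by arith. Qed.

Lemma lt_trichotomy x y : x < y \/ x = y \/ y < x.
Proof.
have [[z ->]|[z ->]] := m_le_total H x y;
  have [->|[u ->]] := m_zero_or_succ H z.
- by right; left; arith.
- by right; right; arith.
- by right; left; arith.
- by left; arith.
Qed.

Lemma le_or_lt x y : x <= y \/ y < x.
Proof. by have [|[->|]] := lt_trichotomy x y; [left|left|right]; arith. Qed.

Definition least_number (P : num M -> Prop) : num M :=
  if pselect (exists n, P n /\ forall k, k < n -> ~ P k) is left h
  then projT1 (cid h) else 0.

Lemma least_numberP (P : num M -> Prop) : rel1 P -> (exists n, P n) ->
  P (least_number P) /\ forall k, k < least_number P -> ~ P k.
Proof.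
move=> dP ex; rewrite /least_number; case: pselect => [h|[]]; last exact: least.
by case: cid.
Qed.

Lemma least_number_eq (P : num M -> Prop) n : P n -> (forall k, k < n -> ~ P k) ->
  least_number P = n.
Proof.
move=> Pn nP; rewrite /least_number; case: pselect => [h|[]]; last by exists n.
case: cid => m /= [Pm nP']; have [|[//|]] := lt_trichotomy m n.
  by move=> /nP.
by move=> /nP'.
Qed.

Lemma rec2_least (P : num M -> num M -> num M -> Prop) : rel3 P ->
  (forall x y, exists z, P x y z) ->
  rec2 (fun x y => least_number (P x y)).
Proof.
move=> dP ex; apply: (@sigma1_ext _ (fun e => P (e 1%N) (e 2%N) (e 0%N) /\
  forall k, k < e 0%N -> ~ P (e 1%N) (e 2%N) k)); last definable.
move=> e; split=> [[Pe nP]|->]; first by rewrite (least_number_eq Pe nP).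
by apply: least_numberP => //; rewrite /rel1; definable.
Qed.

Lemma rec1_least (P : num M -> num M -> Prop) : rel2 P ->
  (forall x, exists z, P x z) -> rec1 (fun x => least_number (P x)).
Proof.
move=> dP ex; apply: (@sigma1_ext _ (fun e => P (e 1%N) (e 0%N) /\
  forall k, k < e 0%N -> ~ P (e 1%N) k)); last definable.
move=> e; split=> [[Pe nP]|->]; first by rewrite (least_number_eq Pe nP).
by apply: least_numberP => //; rewrite /rel1; definable.
Qed.
End Induction.

(** * Finite sets and primitive recursion *)

Definition divides (M : L2structure) (a n : num M) : Prop :=
  exists q, q < n + 1 /\ n = a * q.

(** The number [pair (pair k m) n] codes the set of the [i < k] for which
    [(i+1)m+1] divides [n]. *)
Definition elem (M : L2structure) (i w : num M) : Prop :=
  exists k, k < w + 1 /\ exists m, m < w + 1 /\ exists n, n < w + 1 /\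
  w = pair (pair k m) n /\ i < k /\ divides ((i + 1) * m + 1) n.

Section Coding.
Variables (M : L2structure) (H : RCA0 M).
Implicit Types a b c d i j k l m n q u v w x y z : num M.

Lemma pair_ge_l i j : i <= pair i j.
Proof. rewrite /pair; narith. Qed.

Lemma pair_ge_r i j : j <= pair i j.
Proof.
rewrite /pair; have [->|[u ->]] := m_zero_or_succ H j; narith.
Qed.

Lemma pair_inj i j i' j' : pair i j = pair i' j' -> i = i' /\ j = j'.
Proof.
have low (a b c d : num M) : a + b < c + d -> pair a b <> pair c d.
  by rewrite /pair => /(m_ltP H) [u ->] e; move: e; narith.
move=> e; have [/low|[s|/low]] := lt_trichotomy H (i + j) (i' + j').
- by case.
- by move: e; rewrite /pair s => e; split; arith.
- by case.
Qed.

Lemma divides_mul a q : 0 < a -> divides a (a * q).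
Proof.
move=> /(m_ltP H) [u ->]; exists q; split=> //; narith.
Qed.

(** Bezout computations produce cofactors that may be negative; this turns them into divisibility in
    the model. *)
Lemma divides_int a n (t : model_int H) : 0 < a ->
  of_nat (n : model_nat H) = (of_nat (a : model_nat H) * t)%R -> divides a n.
Proof.
move=> a0 nat; have [q [tq|tq]] := int_cases t.
  rewrite (_ : n = a * q); first exact: divides_mul.
  by apply/(int_eq H); rewrite nat tq (intM H).
have n0 : n = 0.
  by apply/(int_eq H); rewrite nat tq; move: a0 nat; rewrite tq; narith.
by rewrite n0 (_ : 0 = a * 0); [exact: divides_mul | narith].
Qed.

Lemma rel2_divides : rel2 (@divides M).
Proof. by rewrite /rel2 /divides; definable. Qed.
Hint Resolve rel2_divides : definability.

(** Serves in place of the factorial of [k], as primitive recursion is only obtained later from the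
    coding of finite sets. *)
Lemma common_multiple k : exists m, 0 < m /\ forall d, d <= k -> 0 < d -> divides d m.
Proof.
move: k; apply: (induct1 H); first definable.
  exists 1; split; first arith.
  by move=> d dk d0; exfalso; arith.
move=> k [m [m0 hm]]; exists (m * (k + 1)); split.
  by move: m0 => /(m_ltP H) [u ->]; narith.
move=> d dk d0; have [le|lt] := le_or_lt H d k.
  have [q [_ ->]] := hm _ le d0.
  by rewrite -(m_mulA H); exact: divides_mul.
rewrite (_ : d = k + 1); last arith.
by rewrite (m_mulC H); apply: divides_mul; arith.
Qed.

(** Cancellation of [a_i = (i+1)m+1] against [a_j], by the explicit Bezout
    identity [(j+1) a_i - (i+1) a_j = j-i] and [j-i] dividing [m]. *)
Lemma beta_cancel k m i j n : (forall d, d <= k -> 0 < d -> divides d m) ->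
  i < k -> j < k -> i <> j ->
  divides ((j + 1) * m + 1) (n * ((i + 1) * m + 1)) -> divides ((j + 1) * m + 1) n.
Proof.
move=> hm ik jk ij [c [_ e]].
have [Q mQ] : exists Q : model_int H,
    of_nat (m : model_nat H) = ((of_nat (j : model_nat H) - of_nat (i : model_nat H)) * Q)%R.
  have [/(m_ltP H) [d jd]|[//|/(m_ltP H) [d jd]]] := lt_trichotomy H i j.
    have [||q [_ ->]] := hm (d + 1); [arith|arith|].
    by exists (of_nat (q : model_nat H)); rewrite jd !(intM H, intD H, int1 H); ring.
  have [||q [_ ->]] := hm (d + 1); [arith|arith|].
  by exists (- of_nat (q : model_nat H))%R; rewrite jd !(intM H, intD H, int1 H); ring.
pose z x := of_nat (x : model_nat H).
(* Write [a_i = (i+1)m+1]. From [1 = a_i - (i+1) m], [m = (j-i) Q] and the Bezout identity, [1 = a_i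
   (1 - (i+1)(j+1) Q) + (i+1)^2 Q a_j]. Multiplying by [n] and using [n a_i = a_j c] gives this
   cofactor. *)
apply: (@divides_int _ _ (z c * (1 - (z i + 1) * (z j + 1) * Q) + (z i + 1) ^+ 2 * Q * z n)%R).
  by narith.
have e' : (z n * ((z i + 1) * z m + 1) = ((z j + 1) * z m + 1) * z c)%R.
  by move/(int_eq H): e; rewrite /z !(intM H, intD H, int1 H).
transitivity (((z j + 1) * z m + 1) * z c * (1 - (z i + 1) * (z j + 1) * Q) +
  ((z j + 1) * z m + 1) * ((z i + 1) ^+ 2 * Q * z n))%R.
  by rewrite -e' /z mQ; ring.
by rewrite /z !(intM H, intD H, int1 H); ring.
Qed.

(** The code [n] is the product of the moduli [(i+1)m+1] of the members, built one candidate at a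
    time by Sigma1 induction. Coprimality, in the form of [beta_cancel], keeps a new factor from
    admitting other candidates. *)
Lemma finite_set (P : num M -> Prop) k : rel1 P ->
  exists w, forall i, elem i w <-> i < k /\ P i.
Proof.
move=> dP; have [X XP] := comprehension H dP.
have [m [m0 hm]] := common_multiple k.
have a_gt1 i : 1 < (i + 1) * m + 1 by move: m0 => /(m_ltP H) [u ->]; narith.
have [n hn] : exists n, forall i, i < k -> (divides ((i + 1) * m + 1) n <-> i < k /\ i ∈ X).
  apply: (induct1 H (P := fun l => exists n, forall i, i < k ->
    (divides ((i + 1) * m + 1) n <-> i < l /\ i ∈ X))); first definable.
    exists 1 => i ik; split=> [[q [_]]|[]]; last arith.
    move: (a_gt1 i) => /(m_ltP H) [u ->].
    by have [->|[v ->]] := m_zero_or_succ H q; narith.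
  move=> l [n hn]; have [lk|kl] := EM (l < k); last first.
    exists n => i ik; rewrite hn //; split=> -[il iX]; split=> //; arith.
  have [lX|lX] := EM (l ∈ X); last first.
    exists n => i ik; rewrite hn // (lt_succ (RCA0_basic H)).
    by split=> [[]|[[|il]]] //; [split=> //; left|move: lX; rewrite il].
  exists (n * ((l + 1) * m + 1)) => i ik; rewrite (lt_succ (RCA0_basic H)).
  have [->|il] := EM (i = l).
    split=> _; first by split=> //; right.
    by rewrite (m_mulC H n); apply: divides_mul; move: (a_gt1 l); arith.
  split=> [/(beta_cancel hm lk ik (nesym il))|].
    by move/(hn _ ik) => [l1 l2]; split=> //; left.
  move=> [[l1|//] l2]; have [q [_ ->]] := (hn i ik).2 (conj l1 l2).
  by rewrite -(m_mulA H); apply: divides_mul; move: (a_gt1 i); arith.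
exists (pair (pair k m) n) => i; split=> [[k' [_ [m' [_ [n' [_ [e [ik d]]]]]]]]|[ik Pi]].
  have [e1 en] := pair_inj e; have [ek em] := pair_inj e1; subst.
  by rewrite -XP; apply/hn.
have := pair_ge_l k m; have := pair_ge_r k m.
have := pair_ge_l (pair k m) n; have := pair_ge_r (pair k m) n => h1 h2 h3 h4.
exists k; split; first arith.
exists m; split; first arith.
exists n; split; first arith.
do 2 split=> //; by apply/hn; rewrite ?XP.
Qed.

Lemma rel2_elem : rel2 (@elem M).
Proof. by rewrite /rel2 /elem; definable. Qed.

Lemma elem_lt i w : elem i w -> i < w.
Proof.
move=> [k [_ [m [_ [n [_ [-> [ik _]]]]]]]].
have := pair_ge_l k m; have := pair_ge_l (pair k m) n; arith.
Qed.
End Coding.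
#[global] Hint Resolve rel2_divides rel2_elem : definability.

Section PrimitiveRecursion.
Variables (M : L2structure) (g : num M -> num M) (h : num M -> num M -> num M -> num M).
Implicit Types i k n p q u v w : num M.

(** Every element of the finite set coded by [w] is justified by the recursion
    equations, so [w] is a subset of the graph of the function to be defined. *)
Definition computation p w : Prop := forall q, q < w -> elem q w ->
  q = pair 0 (g p) \/
  exists i, i < w /\ exists u, u < w /\ elem (pair i u) w /\ q = pair (i + 1) (h p i u).

Definition computed p n v : Prop := exists w, computation p w /\ elem (pair n v) w.

Definition primrec p n : num M :=
  if pselect (exists v, computed p n v) is left e then projT1 (cid e) else 0.

Hypothesis (H : RCA0 M) (rg : rec1 g) (rh : rec3 h).

Lemma rel2_computation : rel2 computation.
Proof. by rewrite /rel2 /computation; definable. Qed.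
Hint Resolve rel2_computation : definability.

Lemma computed_unique p n v v' : computed p n v -> computed p n v' -> v = v'.
Proof.
move=> [w [cw ew]] [w' [cw' ew']].
(* Bounding [v] and [v'] by the two codes makes the induction formula Delta1. *)
suff: forall n, forall v, v < w -> forall v', v' < w' ->
    elem (pair n v) w -> elem (pair n v') w' -> v = v'.
  move/(_ n v); apply => //.
    by have := pair_ge_r H n v; have := elem_lt H ew; arith.
  by have := pair_ge_r H n v'; have := elem_lt H ew'; arith.
have zS k : 0 <> k + 1 by move=> e; have := succ_neq_zero (RCA0_basic H) (esym e).
clear n v v' ew ew'; apply: (induct1 H); first definable.
  move=> v _ v' _ ev ev'.
  have [|[i [_ [u [_ [_ /(pair_inj H) []]]]]]] := cw _ (elem_lt H ev) ev; last by move=> /zS.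
  move=> /(pair_inj H) [_ ->].
  have [|[i [_ [u [_ [_ /(pair_inj H) []]]]]]] := cw' _ (elem_lt H ev') ev'; last by move=> /zS.
  by move=> /(pair_inj H) [_ ->].
move=> n IH v _ v' _ ev ev'.
have [/(pair_inj H) [/esym/zS//]|] := cw _ (elem_lt H ev) ev.
move=> [i [_ [u [uw [eu /(pair_inj H) [/(succ_inj (RCA0_basic H)) ? ->]]]]]].
have [/(pair_inj H) [/esym/zS//]|] := cw' _ (elem_lt H ev') ev'.
move=> [j [_ [u' [uw' [eu' /(pair_inj H) [/(succ_inj (RCA0_basic H)) ? ->]]]]]].
by subst; rewrite (IH _ uw _ uw' eu eu').
Qed.

Lemma computed0 p : computed p 0 (g p).
Proof.
have [|w hw] := finite_set H (P := fun q => q = pair 0 (g p)) (pair 0 (g p) + 1).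
  by rewrite /rel1; definable.
exists w; split; last by apply/hw; split=> //; arith.
by move=> q _ /hw [_ ->]; left.
Qed.

Lemma computedS p n v : computed p n v -> computed p (n + 1) (h p n v).
Proof.
move=> [w [cw ew]]; have [a ea] : exists a, a = pair (n + 1) (h p n v) by eexists.
have [|w' hw] := finite_set H (P := fun q => elem q w \/ q = a) (w + a + 1).
  by rewrite /rel1; definable.
have sub q : elem q w -> elem q w'.
  move=> eq; apply/hw; split; last by left.
  by have := elem_lt H eq; arith.
have elem_bounds i u : elem (pair i u) w' -> i < w' /\ u < w'.
  move=> /(elem_lt H); have := pair_ge_l H i u; have := pair_ge_r H i u.
  by move=> *; split; arith.
exists w'; rewrite -ea; split; last by apply/hw; split; [arith | right].
move=> q _ /hw [_ [eq|->]]; last first.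
  right; exists n; rewrite ea; have [? ?] := elem_bounds _ _ (sub _ ew); split=> //.
  by exists v; do 2 split=> //; exact: sub.
have [->|] := cw _ (elem_lt H eq) eq; first by left.
move=> [i [_ [u [_ [eu qu]]]]]; right.
have [? ?] := elem_bounds _ _ (sub _ eu).
by exists i; split=> //; exists u; do 2 split=> //; exact: sub.
Qed.

Lemma computed_total p n : exists v, computed p n v.
Proof.
move: n; apply: (induct1 H).
- rewrite /computed; definable.
- by exists (g p); apply: computed0.
- by move=> n [v cv]; exists (h p n v); apply: computedS.
Qed.

Lemma primrecP p n : computed p n (primrec p n).
Proof.
rewrite /primrec; case: pselect => [e|[]]; last exact: computed_total.
by case: cid.
Qed.

Lemma primrec0 p : primrec p 0 = g p.
Proof. exact: computed_unique (primrecP p 0) (computed0 p). Qed.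

Lemma primrecS p n : primrec p (n + 1) = h p n (primrec p n).
Proof. exact: computed_unique (primrecP _ _) (computedS (primrecP _ _)). Qed.

Lemma rec2_primrec : rec2 primrec.
Proof.
apply: (@sigma1_ext _ (fun e => computed (e 1%N) (e 2%N) (e 0%N))) => [e|].
  split=> [c|->]; last exact: primrecP.
  exact: computed_unique c (primrecP _ _).
rewrite /computed; definable.
Qed.
End PrimitiveRecursion.

Section Graphs.
Variables (M : L2structure) (H : RCA0 M).

Lemma graph_set (A : num M -> Prop) (f : num M -> num M) : rel1 A -> rec1 f ->
  exists F, (forall k, k ∈ F -> exists i, A i /\ k = pair i (f i)) /\
    forall i j, maps F i j <-> A i /\ j = f i.
Proof.
move=> dA rf.
have [|F hF] := comprehension H (P := fun k => exists i, i < k + 1 /\ A i /\ k = pair i (f i)).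
  by rewrite /rel1; definable.
exists F; split=> [k /hF [i [_ h]]|i j]; first by exists i.
rewrite /maps hF; split=> [[i' [_ [Ai /(pair_inj H) [-> ->]]]]|[Ai ->]] //.
by exists i; split=> //; have := pair_ge_l H i (f i); arith.
Qed.

Lemma graph_function (A B : num M -> Prop) F (f : num M -> num M) :
  (forall k, k ∈ F -> exists i, A i /\ k = pair i (f i)) ->
  (forall i j, maps F i j <-> A i /\ j = f i) ->
  (forall i, A i -> B (f i)) -> is_function A B F.
Proof.
move=> F1 F2 AB; split=> [k /F1 [i [Ai ->]]|].
  by exists i, (f i); split=> //; split=> //; exact: AB.
split=> [i j j' /F2 [_ ->] /F2 [_ ->] //|i Ai]; exists (f i); split; first exact: AB.
exact/F2.
Qed.

Lemma rel2_maps (F : sets M) : rel2 (maps F).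
Proof. by rewrite /rel2 /maps; definable. Qed.
End Graphs.
#[global] Hint Resolve rel2_maps : definability.

(** * Parity, powers of two and the bits of a string *)

Definition even (M : L2structure) (n : num M) : Prop := exists h, h < n + 1 /\ n = h + h.

Definition pow2 (M : L2structure) : num M -> num M :=
  primrec (fun _ => 1) (fun _ _ v => v + v) 0.

Section Strings.
Variables (M : L2structure) (H : RCA0 M).
Implicit Types d h i j k m n p q r s t u x y z : num M.

Lemma rel1_even : rel1 (@even M).
Proof. by rewrite /rel1 /even; definable. Qed.

Lemma evenP n : even n <-> exists h, n = h + h.
Proof. by split=> [[h [_ e]]|[h e]]; exists h => //; split=> //; arith. Qed.

Lemma parity n : (exists h, n = h + h) \/ (exists h, n = h + h + 1).
Proof.
suff : even n \/ (exists h, h < n + 1 /\ n = h + h + 1).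
  by move=> [/evenP|[h [_ ->]]]; [left|right; exists h].
have := rel1_even => ?.
move: n; apply: (induct1 H); first definable.
  by left; exists 0; split; arith.
move=> n [/evenP [h ->]|[h [_ ->]]]; first by right; exists h; split; arith.
by left; exists (h + 1); split; arith.
Qed.

Lemma even_odd h k : h + h <> k + k + 1.
Proof.
move=> e; have [/(m_ltP H) [u v]|[v|/(m_ltP H) [u v]]] := lt_trichotomy H h k;
  move: e; rewrite v; arith.
Qed.

Lemma even_double h : even (h + h).
Proof. by apply/evenP; exists h. Qed.

Lemma odd_not_even h : ~ even (h + h + 1).
Proof. by move=> /evenP [k /esym/even_odd]. Qed.

Lemma even_add m n : even (m + n) <-> (even m <-> even n).
Proof.
have [[h ->]|[h ->]] := parity m; have [[k ->]|[k ->]] := parity n.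
- rewrite (_ : _ + _ = (h + k) + (h + k)); last arith.
  by have := even_double h; have := even_double k; have := even_double (h + k); tauto.
- rewrite (_ : _ + _ = (h + k) + (h + k) + 1); last arith.
  by have := even_double h; have := @odd_not_even k; have := @odd_not_even (h + k); tauto.
- rewrite (_ : _ + _ = (h + k) + (h + k) + 1); last arith.
  by have := even_double k; have := @odd_not_even h; have := @odd_not_even (h + k); tauto.
- rewrite (_ : _ + _ = (h + k + 1) + (h + k + 1)); last arith.
  have := even_double (h + k + 1); have := @odd_not_even h; have := @odd_not_even k; tauto.
Qed.

Lemma pow2_0 : pow2 0 = 1 :> num M.
Proof. by rewrite /pow2 primrec0 //; rewrite ?/rec1 ?/rec3; definable. Qed.

Lemma pow2_S n : pow2 (n + 1) = pow2 n + pow2 n.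
Proof. by rewrite /pow2 primrecS //; rewrite ?/rec1 ?/rec3; definable. Qed.

Lemma pow2_1 : pow2 1 = 1 + 1 :> num M.
Proof. by rewrite -[X in pow2 X]m_add0 // pow2_S pow2_0. Qed.

Lemma rec1_pow2 : rec1 (@pow2 M).
Proof.
have : rec2 (primrec (fun _ => 1) (fun _ _ v : num M => v + v)).
  by apply: rec2_primrec => //; rewrite ?/rec1 ?/rec3; definable.
by rewrite /rec1 /pow2 => ?; definable.
Qed.
Hint Resolve rel1_even rec1_pow2 : definability.

Lemma pow2_gt n : n < pow2 n.
Proof.
move: n; apply: (induct1 H); first definable.
  by rewrite pow2_0; arith.
by move=> n IH; rewrite pow2_S; arith.
Qed.

Lemma pow2_add m n : pow2 (m + n) = pow2 m * pow2 n.
Proof.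
move: n; apply: (induct1 H); first definable.
  by rewrite pow2_0 (add_zero (RCA0_basic H)); narith.
by move=> n IH; rewrite (m_addA H) !pow2_S IH; narith.
Qed.

Lemma pow2_le m n : m <= n -> pow2 m <= pow2 n.
Proof.
move=> mn; have [[z ->]|[z e]] := m_le_total H n m; last by rewrite (_ : m = n); arith.
by rewrite pow2_add; have := pow2_gt z; have := pow2_gt m; narith.
Qed.

(** An odd divisor of [2^(n+1)] has an even cofactor, so it already divides [2^n]; descending to
    [n = 0] shows that it is 1. *)
Lemma pow2_power_of_two n : power_of_two (pow2 n).
Proof.
split=> [e|d q]; first by have := pow2_gt n; rewrite e; arith.
have [[h ->] _|[h dh]] := parity d; first by right; exists h; arith.
suff: forall n, forall q, q < pow2 n + 1 -> pow2 n = d * q -> d = 1.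
  move=> h1 e; left; apply: (h1 n q) => //.
  by rewrite e dh; narith.
clear n q; apply: (induct1 H); first definable.
  rewrite pow2_0 => q _; rewrite dh.
  have [->|[u ->]] := m_zero_or_succ H h; first arith.
  have [->|[v ->]] := m_zero_or_succ H q; narith.
move=> n IH q _; rewrite pow2_S => e.
have [[k qk]|[k qk]] := parity q.
  have pk : pow2 n = d * k by move: e; rewrite qk; narith.
  apply: (IH k) => //; rewrite pk dh; narith.
exfalso; apply: (@even_odd (pow2 n) (h * (k + k) + h + k)).
by rewrite e dh qk; narith.
Qed.

(** Take the least cofactor [q] of a power [2^k] in [p]. An even [q] could be halved by passing to
    [2^(k+1)], so [q] is 1. *)
Lemma power_of_two_pow2 p : power_of_two p -> exists n, p = pow2 n.
Proof.
move=> [p0 hp].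
have [||q [[k [kp pq]] hq]] :=
  least H (P := fun q => exists k, k < p + 1 /\ p = pow2 k * q).
- by rewrite /rel1; definable.
- by exists p, 0; rewrite pow2_0; split; narith.
have [q1|[h qh]] := hp q (pow2 k) (etrans pq (m_mulC H _ _)).
  by exists k; rewrite pq q1; narith.
have [h0|[h' hh]] := m_zero_or_succ H h.
  by case: p0; rewrite pq qh h0; narith.
case: (hq h); first by rewrite qh hh; arith.
have e : p = pow2 (k + 1) * h by rewrite pow2_S pq qh; narith.
exists (k + 1); split=> //; have := pow2_gt (k + 1); rewrite e hh; narith.
Qed.

Lemma initial_segmentP s t :
  initial_segment s t <-> exists k r, r < pow2 k /\ t = s * pow2 k + r.
Proof.
split=> [[p [r [/power_of_two_pow2 [k ->] [rp ->]]]]|[k [r [rk ->]]]].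
  by exists k, r.
by exists (pow2 k), r; split=> //; exact: pow2_power_of_two.
Qed.

Lemma string_length s : s <> 0 -> exists k r, r < pow2 k /\ s = pow2 k + r.
Proof.
move=> s0; have [||n [sn hn]] := least H (P := fun n => s < pow2 n).
- by rewrite /rel1; definable.
- by exists s; exact: pow2_gt.
have [n0|[k nk]] := m_zero_or_succ H n.
  by case: s0; move: sn; rewrite n0 pow2_0; arith.
have [/(m_ltP H) [r sr]|[sr|sk]] := lt_trichotomy H (pow2 k) s.
- exists k, (r + 1); split; last by rewrite sr; arith.
  by move: sn; rewrite sr nk pow2_S; arith.
- by exists k, 0; split; [have := pow2_gt k|]; arith.
- by case: (hn k) => //; rewrite nk; arith.
Qed.

(** The string coded by [s] has bit [i] at position [x]: it splits as a string
    [u] of length [x], the bit [i] and a string of length [k]. *)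
Definition bit s x i : Prop :=
  exists u, u < s + 1 /\ exists k, k < s + 1 /\ exists r, r < pow2 k /\
  s = (u + u + i) * pow2 k + r /\ pow2 x <= u /\ u < pow2 (x + 1).

Lemma rel3_bit : rel3 bit.
Proof. by rewrite /rel3 /bit; definable. Qed.

Lemma bit_intro u k r x i : r < pow2 k -> pow2 x <= u -> u < pow2 (x + 1) ->
  bit ((u + u + i) * pow2 k + r) x i.
Proof.
move=> rk xu ux; have k1 := pow2_gt k; have x1 := pow2_gt x.
exists u; split; last exists k; last split; last by exists r.
  by narith.
by narith.
Qed.

Lemma bit_extend s x i k r : r < pow2 k -> bit s x i -> bit (s * pow2 k + r) x i.
Proof.
move=> rk [u [_ [k' [_ [r' [rk' [-> [xu ux]]]]]]]].
rewrite (_ : _ + r = (u + u + i) * pow2 (k' + k) + (r' * pow2 k + r)).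
  by apply: bit_intro => //; rewrite pow2_add; move: rk => /(m_ltP H) [a ->];
     move: rk' => /(m_ltP H) [b ->]; narith.
by rewrite pow2_add; narith.
Qed.

Lemma div_unique a b k r r' : r < k -> r' < k -> a * k + r = b * k + r' -> a = b.
Proof.
move=> rk rk' e; have [/(m_ltP H) [u v]|[//|/(m_ltP H) [u v]]] := lt_trichotomy H a b;
  by exfalso; move: e; rewrite v; narith.
Qed.

Lemma bit_unique s x i j : i < 2 -> j < 2 -> bit s x i -> bit s x j -> i = j.
Proof.
move=> i2 j2 [u [_ [k [_ [r [rk [su [xu ux]]]]]]]] [v [_ [l [_ [t [tl [sv [xv vx]]]]]]]].
(* Each decomposition locates [s] between two consecutive powers of two, so the tails have equal
   length; division by that power then gives equal prefixes, whose parities are the bits. *)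
have bounds w (a b c : num M) : a < 2 -> b < pow2 c -> pow2 x <= w -> w < pow2 (x + 1) ->
    s = (w + w + a) * pow2 c + b ->
    pow2 (x + 1 + c) <= s /\ s < pow2 (x + 1 + c + 1).
  move=> a2 bc xw wx ->; rewrite pow2_S pow2_add; have := pow2_gt c.
  by move: xw wx; rewrite !pow2_S; split; narith.
have [b1 b2] := bounds _ _ _ _ i2 rk xu ux su.
have [b3 b4] := bounds _ _ _ _ j2 tl xv vx sv.
have kl : k = l.
  have [kl|[//|kl]] := lt_trichotomy H k l; exfalso.
    have : pow2 (x + 1 + k + 1) <= pow2 (x + 1 + l) by apply: pow2_le; arith.
    by arith.
  have : pow2 (x + 1 + l + 1) <= pow2 (x + 1 + k) by apply: pow2_le; arith.
  by arith.
subst l; have := @div_unique (u + u + i) (v + v + j) _ _ _ rk tl (etrans (esym su) sv).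
have i01 (a : num M) : a < 2 -> a = 0 \/ a = 1.
  have [->|[b ->]] := m_zero_or_succ H a; first by left.
  by right; have := of_nat_ge0 (b : model_nat H); arith.
move: (i01 _ i2) (i01 _ j2) => [->|->] [->|->] // e; exfalso.
  by apply: (@even_odd u v); arith.
by apply: (@even_odd v u); arith.
Qed.
End Strings.
#[global] Hint Resolve rel1_even rec1_pow2 rel3_bit : definability.

(** * Colorings from weak König's lemma *)

Definition gplus (M : L2structure) (G : group_data M) (x y : num M) : num M :=
  if pselect (exists z, gsum G x y z) is left h then projT1 (cid h) else 0.

Definition mult (M : L2structure) (G : group_data M) (b n : num M) : num M :=
  primrec (fun _ => gzero G) (fun _ _ v => gplus G v b) 0 n.

Section Groups.
Variables (M : L2structure) (H : RCA0 M) (G : group_data M) (AG : is_abelian_group G).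
Implicit Types d h i j k l m n p q r s t u x y z : num M.
Local Notation "x ⊕ y" := (gplus G x y) (at level 50, left associativity).
Local Notation inG := (in_group G).

Lemma gsum_in x y z : gsum G x y z -> [/\ inG x, inG y & inG z].
Proof.
move=> h; have [/(_ _ h) [p [q [[x' [y' [Gx [Gy e]]]] [Gz e']]]] _] := gadd_function AG.
have [e1 e2] := pair_inj H e'; subst p q.
by have [e3 e4] := pair_inj H e1; subst.
Qed.

Lemma gsum_unique x y z z' : gsum G x y z -> gsum G x y z' -> z = z'.
Proof. by have [_ [u _]] := gadd_function AG; exact: u. Qed.

Lemma gplusP x y : inG x -> inG y -> gsum G x y (x ⊕ y).
Proof.
move=> Gx Gy; rewrite /gplus; case: pselect => [h|[]]; first by case: cid.
have [_ [_ t]] := gadd_function AG.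
by have [|z [_ h]] := t (pair x y); [exists x, y | exists z].
Qed.

Lemma gsumP x y z : gsum G x y z <-> [/\ inG x, inG y & z = x ⊕ y].
Proof.
split=> [h|[Gx Gy ->]]; last exact: gplusP.
by have [Gx Gy _] := gsum_in h; split=> //; exact: gsum_unique h (gplusP Gx Gy).
Qed.

Lemma gplus_in x y : inG x -> inG y -> inG (x ⊕ y).
Proof. by move=> Gx Gy; have [] := gsum_in (gplusP Gx Gy). Qed.

Lemma gplusA x y z : inG x -> inG y -> inG z -> (x ⊕ y) ⊕ z = x ⊕ (y ⊕ z).
Proof.
move=> Gx Gy Gz; have Gxy := gplus_in Gx Gy.
have := gadd_assoc AG (gplusP Gx Gy) (gplusP Gy Gz) (gplusP Gxy Gz).
by case/gsumP.
Qed.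

Lemma gplusC x y : inG x -> inG y -> x ⊕ y = y ⊕ x.
Proof. by move=> Gx Gy; case/gsumP: (gadd_comm AG (gplusP Gx Gy)). Qed.

Lemma gplus0 x : inG x -> x ⊕ gzero G = x.
Proof. by move=> Gx; case/gsumP: (gadd_zero AG Gx). Qed.

Lemma gopp_ex x : inG x -> exists y, [/\ maps (gopp G) x y, inG y & x ⊕ y = gzero G].
Proof.
move=> Gx; have [_ [_ t]] := gopp_function AG; have [y [Gy xy]] := t _ Gx.
by exists y; split=> //; case/gsumP: (gadd_opp AG xy).
Qed.

Lemma gplus_cancel x y z : inG x -> inG y -> inG z -> x ⊕ z = y ⊕ z -> x = y.
Proof.
move=> Gx Gy Gz e; have [w [_ Gw zw]] := gopp_ex Gz.
by rewrite -(gplus0 Gx) -(gplus0 Gy) -zw -!gplusA // e.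
Qed.

Lemma gdiffP x y z : inG x -> inG y -> inG z -> gdiff G x y z <-> x = z ⊕ y.
Proof.
move=> Gx Gy Gz; split=> [[w [yw /gsumP [_ Gw ->]]]|->].
  have e : y ⊕ w = gzero G by case/gsumP: (gadd_opp AG yw).
  by rewrite gplusA // (gplusC Gw) // e gplus0.
have [w [yw Gw e]] := gopp_ex Gy; exists w; split=> //; apply/gsumP.
by split=> //; [exact: gplus_in | rewrite gplusA // e gplus0].
Qed.

Lemma rel1_in_group : rel1 inG.
Proof. exact: rel1_mem. Qed.

Lemma rel3_gsum : rel3 (gsum G).
Proof. by rewrite /rel3 /gsum; definable. Qed.
Hint Resolve rel1_in_group rel3_gsum : definability.

Lemma rec2_gplus : rec2 (gplus G).
Proof.
apply: (@sigma1_ext _ (fun e => gsum G (e 1%N) (e 2%N) (e 0%N) \/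
   (~ (inG (e 1%N) /\ inG (e 2%N)) /\ e 0%N = 0))); last definable.
move=> e; split=> [[/gsumP [] //|[nG ->]]|->].
  by rewrite /gplus; case: pselect => // h; case: nG; case: h => z /gsumP [].
have [[G1 G2]|nG] := EM (inG (e 1%N) /\ inG (e 2%N)); [left|right; split=> //].
  exact: gplusP.
by rewrite /gplus; case: pselect => // h; case: nG; case: h => z /gsumP [].
Qed.
Hint Resolve rec2_gplus : definability.

Section Multiples.
Variable b : num M.
Hypothesis Gb : inG b.

Let rec_zero : rec1 (fun _ : num M => gzero G).
Proof. by rewrite /rec1; definable. Qed.

Let rec_step : rec3 (fun _ _ v : num M => v ⊕ b).
Proof. by rewrite /rec3; definable. Qed.

Lemma mult0 : mult G b 0 = gzero G.
Proof. by rewrite /mult primrec0. Qed.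

Lemma multS n : mult G b (n + 1) = mult G b n ⊕ b.
Proof. by rewrite /mult primrecS. Qed.

Lemma rec1_mult : rec1 (mult G b).
Proof.
have : rec2 (primrec (fun _ => gzero G) (fun _ _ v => v ⊕ b)) by apply: rec2_primrec.
by rewrite /rec1 /mult => ?; definable.
Qed.
Hint Resolve rec1_mult : definability.

Lemma mult_in n : inG (mult G b n).
Proof.
move: n; apply: (induct1 H); first definable.
  by rewrite mult0; exact: gzero_in.
by move=> n Gn; rewrite multS; exact: gplus_in.
Qed.

Lemma mult_add m n : mult G b (m + n) = mult G b m ⊕ mult G b n.
Proof.
move: n; apply: (induct1 H); first definable.
  by rewrite (add_zero (RCA0_basic H)) mult0 gplus0 //; exact: mult_in.
move=> n IH; rewrite (m_addA H) !multS IH gplusA //; exact: mult_in.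
Qed.

Lemma mult_fixed k d : mult G b (k + d) = mult G b k -> mult G b d = gzero G.
Proof.
move=> e; have Gk := mult_in k; have Gd := mult_in d; have G0 := gzero_in AG.
apply: (gplus_cancel Gd G0 Gk).
by rewrite (gplusC Gd Gk) -mult_add e (gplusC G0 Gk) gplus0.
Qed.

(** Every set witnessing [is_multiples] agrees with the primitive recursive [mult] by induction, and
    the graph of [mult] is such a set. *)
Lemma multipleP n x : multiple G n b x <-> x = mult G b n.
Proof.
split=> [[f [[[f1 [f2 f3]] [f0 fS]] fn]]|->].
  suff: forall n, maps f n (mult G b n) by move=> h; exact: f2 fn (h n).
  apply: (induct1 H); first definable.
    by rewrite mult0.
  move=> k h; apply: fS h _; rewrite multS; apply: gplusP => //; exact: mult_in.
have [F [F1 F2]] := graph_set H (delta1_const _ True : rel1 (numbers M)) rec1_mult.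
exists F; split; last exact/F2.
split; first by apply: graph_function F1 F2 _ => i _; exact: mult_in.
split; first by apply/F2; rewrite mult0.
by move=> i x' y /F2 [_ ->] /gsumP [_ _ ->]; apply/F2; rewrite multS.
Qed.
End Multiples.
End Groups.
#[global] Hint Resolve rel1_in_group rel3_gsum rec2_gplus rec1_mult : definability.

(** * Colorings when the order of the element is finite *)

Section FiniteOrder.
Variables (M : L2structure) (H : RCA0 M) (G : group_data M) (AG : is_abelian_group G).
Variables (b N : num M).
Hypotheses (Gb : in_group G b) (N_gt0 : 0 < N) (N_mult : mult G b N = gzero G).
Hypothesis N_min : forall m, 0 < m -> m < N -> mult G b m <> gzero G.
Implicit Types d h i j k l m n p q r s t u x y z : num M.
Local Notation "x ⊕ y" := (gplus G x y) (at level 50, left associativity).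
Local Notation inG := (in_group G).

Lemma mult_inj i j : i < N -> j < N -> mult G b i = mult G b j -> i = j.
Proof.
have low k d : k + d + 1 < N -> mult G b k <> mult G b (k + d + 1).
  move=> dN; rewrite -(m_addA H) => /esym/(mult_fixed H AG Gb).
  by apply: N_min; arith.
move=> iN jN e; have [/(m_ltP H) [d ji]|[//|/(m_ltP H) [d ij]]] := lt_trichotomy H i j.
  by case: (low i d); rewrite -?ji.
by case: (low j d); rewrite -?ij.
Qed.

(** Translating [x] by [j b] yields the least number in the coset of [x]. *)
Definition to_least x j : Prop :=
  j < N /\ forall j', j' < N -> x ⊕ mult G b j <= x ⊕ mult G b j'.

Lemma rel2_to_least : rel2 to_least.
Proof. by rewrite /rel2 /to_least; definable. Qed.
Hint Resolve rel2_to_least : definability.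

Lemma to_least_ex x : exists j, to_least x j.
Proof.
have [||v [[j [jN vj]] hv]] := least H (P := fun v => exists j, j < N /\ v = x ⊕ mult G b j).
- by rewrite /rel1; definable.
- by exists (x ⊕ mult G b 0), 0.
exists j; split=> // j' j'N; rewrite -vj.
by have [//|l] := le_or_lt H v (x ⊕ mult G b j'); case: (hv _ l); exists j'.
Qed.

Lemma to_least_unique x i j : inG x -> to_least x i -> to_least x j -> i = j.
Proof.
move=> Gx [iN hi] [jN hj]; apply: mult_inj => //.
have e : x ⊕ mult G b i = x ⊕ mult G b j by have := hi _ jN; have := hj _ iN; arith.
have Gi := mult_in H AG Gb i; have Gj := mult_in H AG Gb j.
by move: e; rewrite !(gplusC H AG Gx) //; exact: gplus_cancel.
Qed.

(** As [(y + b) + j b = y + (j + 1) b], both elements reach the same coset minimum and their offsets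
    differ by one modulo [N]. *)
Lemma to_least_step y j : inG y -> to_least (y ⊕ b) j ->
  (j + 1 < N /\ to_least y (j + 1)) \/ (j + 1 = N /\ to_least y 0).
Proof.
move=> Gy [jN hj]; have shift i : (y ⊕ b) ⊕ mult G b i = y ⊕ mult G b (i + 1).
  rewrite multS // (gplusC H AG (mult_in H AG Gb i) Gb) gplusA //; exact: mult_in.
have min i : i < N -> (y ⊕ b) ⊕ mult G b j <= y ⊕ mult G b i.
  have [->|[k ->]] := m_zero_or_succ H i => iN; last first.
    by rewrite -shift; apply: hj; arith.
  (* For [i = 0] the element is [y + N b], which is [N - 1] steps away from [y + b]. *)
  have [N0|[k Nk]] := m_zero_or_succ H N; first by move: N_gt0; rewrite N0; arith.
  by rewrite mult0 // -N_mult Nk -shift; apply: hj; rewrite Nk; arith.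
have [l|[e|l]] := lt_trichotomy H (j + 1) N; last by exfalso; arith.
  by left; do 2 split=> //; move=> i; rewrite -shift; exact: min.
right; do 2 split=> //; move=> i iN; rewrite mult0 // -N_mult -e -shift; exact: min.
Qed.

(** The color of [x] depends only on its offset to the coset minimum, so it suffices to color a
    cycle of length [N] properly; the last hypothesis is the edge that closes the cycle. *)
Lemma finite_order_coloring k (col : num M -> num M) : rec1 col ->
  (forall j, col j < k) -> (forall j, j + 1 < N -> col j <> col (j + 1)) ->
  (forall j, j + 1 = N -> col j <> col 0) ->
  exists c, is_coloring G k c /\ forall x y, ~ monochromatic_solution G b c x y.
Proof.
move=> rcol colk colS colN; pose J x := least_number (to_least x).
have rJ : rec1 J by apply: rec1_least => //; [exact: rel2_to_least | exact: to_least_ex].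
have JP x : to_least x (J x).
  have dJ : rel1 (to_least x) by rewrite /rel1; definable.
  by have [] := least_numberP H dJ (to_least_ex x).
have rc : rec1 (fun x => col (J x)) by rewrite /rec1; definable.
have [c [c1 c2]] := graph_set H (rel1_in_group G) rc.
exists c; split; first by apply: (graph_function c1 c2) => i _; exact: colk.
move=> x y [Gx [Gy [/(gdiffP H AG Gx Gy Gb) e [i [/c2 [_ ->] /c2 [_]]]]]].
have xy : x = y ⊕ b by rewrite e; exact: gplusC.
have := JP x; rewrite {1}xy => /(to_least_step Gy) [[jN h]|[jN h]].
  by rewrite (to_least_unique Gy (JP y) h); exact: colS.
by rewrite (to_least_unique Gy (JP y) h); exact: colN.
Qed.
End FiniteOrder.

(** * Colorings when the order of the element is infinite *)

Section InfiniteOrder.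
Variables (M : L2structure) (H : RCA0 M) (G : group_data M) (AG : is_abelian_group G).
Variable b : num M.
Hypotheses (Gb : in_group G b) (b_infinite : forall m, 0 < m -> mult G b m <> gzero G).
Implicit Types d h i j k l m n p q r s t u x y z : num M.
Local Notation "x ⊕ y" := (gplus G x y) (at level 50, left associativity).
Local Notation inG := (in_group G).
Local Notation "k ⋅ b" := (mult G b k) (at level 40).

Lemma mult_inj_infinite i j : i ⋅ b = j ⋅ b -> i = j.
Proof.
have low k d : k ⋅ b <> (k + d + 1) ⋅ b.
  by rewrite -(m_addA H) => /esym/(mult_fixed H AG Gb); apply: b_infinite; arith.
move=> e; have [/(m_ltP H) [d ji]|[//|/(m_ltP H) [d ij]]] := lt_trichotomy H i j.
  by case: (low i d); rewrite -?ji.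
by case: (low j d); rewrite -?ij.
Qed.

(** When [x + k b = y + l b], alternation demands that [i + k] and [j + l] have equal parity. All
    quantifiers are bounded here; the multiples [k] and [l] stay outside as arguments. *)
Definition conflict s n k l : Prop :=
  exists x, x < n /\ exists y, y < n /\ exists i, i < 2 /\ exists j, j < 2 /\
  ((inG x /\ inG y /\ x ⊕ k ⋅ b = y ⊕ l ⋅ b) /\
   (bit s x i /\ bit s y j /\ ~ even (i + k + (j + l)))).

Definition has_bits s n : Prop := forall x, x < n -> exists i, i < 2 /\ bit s x i.

(** [s] codes a coloring of the numbers below [n] along which adding [b] always
    changes the color, even through multiples of [b] outside of the coded range. *)
Definition alternating s n : Prop :=
  pow2 n <= s /\ has_bits s n /\ forall k l, ~ conflict s n k l.

Lemma bit_cases i : i < 2 -> i = 0 \/ i = 1.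
Proof.
have [->|[u ->]] := m_zero_or_succ H i; first by left.
by right; have := of_nat_ge0 (u : model_nat H); arith.
Qed.

Lemma gplus_mult_comm x k l : inG x -> x ⊕ k ⋅ b ⊕ l ⋅ b = x ⊕ (k + l) ⋅ b.
Proof. by move=> Gx; rewrite mult_add // gplusA //; exact: mult_in. Qed.

(** If [n] lies in the coset of some [y0 < n], its color is forced by [y0], and any other such [y]
    forces the same color since [y0] and [y] do not conflict. Otherwise either color will do. The
    case distinction is not decidable in the model, but only the existence of an extension is
    claimed. *)
Lemma alternating_extend s n : s < pow2 (n + 1) -> alternating s n ->
  exists i, i < 2 /\ alternating (2 * s + i) (n + 1).
Proof.
move=> sn [ns [hs good]].
have lt12 : (1 : num M) < 2 by arith.
have lt02 : (0 : num M) < 2 by arith.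
suff [i [i2 hi]] : exists i, i < 2 /\ forall y k l j, y < n -> j < 2 -> inG n -> inG y ->
    n ⊕ k ⋅ b = y ⊕ l ⋅ b -> bit s y j -> even (i + k + (j + l)).
  have ext x j : bit s x j -> bit (2 * s + i) x j.
    have -> : 2 * s + i = s * pow2 1 + i.
      by rewrite (pow2_1 H); arith.
    apply: bit_extend => //.
    by rewrite (pow2_1 H); arith.
  have new : bit (2 * s + i) n i.
    have -> : 2 * s + i = (s + s + i) * pow2 0 + 0 by rewrite (pow2_0 H); arith.
    by apply: bit_intro => //; rewrite (pow2_0 H); arith.
  exists i; split=> //; split; first by rewrite (pow2_S H); arith.
  split=> [x|k l [x [xn [y [yn [p [p2 [q [q2 [[Gx [Gy e]] [bx [by_ []]]]]]]]]]]]].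
    case/(lt_succ (RCA0_basic H)) => [/hs [j [j2 hj]]|->]; last by exists i.
    by exists j; split=> //; exact: ext.
  move: xn yn; rewrite !(lt_succ (RCA0_basic H)) => -[xn|xn] [yn|yn].
  - apply: contrapT => odd; apply: (good k l); exists x; split=> //; exists y; split=> //.
    have [p' [p2' bx']] := hs _ xn; have [q' [q2' by']] := hs _ yn.
    have ? := bit_unique H p2 p2' bx (ext _ _ bx'); subst p'.
    have ? := bit_unique H q2 q2' by_ (ext _ _ by'); subst q'.
    by exists p; split=> //; exists q.
  - subst y; have [p' [p2' bx']] := hs _ xn.
    have ? := bit_unique H p2 p2' bx (ext _ _ bx'); subst p'.
    rewrite (bit_unique H q2 i2 by_ new) (m_addC H).
    exact: (hi x) xn p2 Gy Gx (esym e) bx'.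
  - subst x; have [q' [q2' by']] := hs _ yn.
    have ? := bit_unique H q2 q2' by_ (ext _ _ by'); subst q'.
    rewrite (bit_unique H p2 i2 bx new).
    exact: (hi y) yn q2 Gx Gy e by'.
  - subst x y; rewrite (bit_unique H p2 i2 bx new) (bit_unique H q2 i2 by_ new).
    have -> : k = l.
      apply: mult_inj_infinite; move: e; rewrite !(gplusC H AG Gx); try exact: mult_in.
      by apply: gplus_cancel => //; exact: mult_in.
    exact: even_double.
have [[y0 [k0 [l0 [j0 [yn0 [j02 [Gn [Gy0 [e0 b0]]]]]]]]]|none] := EM (exists y k l j,
    y < n /\ j < 2 /\ inG n /\ inG y /\ n ⊕ k ⋅ b = y ⊕ l ⋅ b /\ bit s y j); last first.
  exists 0; split=> // y k l j *; case: none.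
  by exists y, k, l, j.
have [i [i2 ei]] : exists i, i < 2 /\ even (i + k0 + (j0 + l0)).
  have [[h e]|[h e]] := parity H (k0 + (j0 + l0)).
    exists 0; split=> //; apply/(evenP H); exists h; arith.
  exists 1; split=> //; apply/(evenP H); exists (h + 1); arith.
exists i; split=> // y k l j yn j2 _ Gy e by_.
have sum : y0 ⊕ (l0 + k) ⋅ b = y ⊕ (l + k0) ⋅ b.
  rewrite -!gplus_mult_comm // -e0 -e !gplus_mult_comm //; congr (_ ⊕ _ ⋅ b); arith.
have E : even (j0 + (l0 + k) + (j + (l + k0))).
  apply: contrapT => odd; apply: (good (l0 + k) (l + k0)).
  by exists y0; split=> //; exists y; split=> //; exists j0; split=> //; exists j.
(* The two even sums already known add up to the wanted one plus twice [k0 + j0 + l0]. *)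
have : even ((i + k + (j + l)) + ((k0 + (j0 + l0)) + (k0 + (j0 + l0)))).
  have := (even_add H (i + k0 + (j0 + l0)) (j0 + (l0 + k) + (j + (l + k0)))).2.
  have -> : i + k0 + (j0 + l0) + (j0 + (l0 + k) + (j + (l + k0))) =
    i + k + (j + l) + (k0 + (j0 + l0) + (k0 + (j0 + l0))) by arith.
  by apply.
by move/(even_add H); have := even_double H (k0 + (j0 + l0)); tauto.
Qed.

Lemma alternating_exists n : exists s, s < pow2 (n + 1) /\ alternating s n.
Proof.
move: n; apply: (pi1_induction H).
(* The bound on [s] makes the claim Pi1: its negation assigns an unbounded witness [k], [l] to each
   proper candidate among boundedly many codes, which is Sigma1 by collection. *)
- apply: (@sigma1_ext _ (fun e => forall s, s < pow2 (e 0%N + 1) ->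
    ~ (pow2 (e 0%N) <= s /\ has_bits s (e 0%N)) \/
    exists k l, conflict s (e 0%N) k l)) => [e|]; last first.
    rewrite /has_bits /conflict; definable.
  split=> [h [s [/h [nb|[k [l c]]] [b1 [b2 b3]]]]|h s sn].
  + by apply: nb.
  + exact: b3 c.
  + apply: contrapT; rewrite not_orE => -[/contrapT [b1 b2] b3]; apply: h; exists s; split=> //.
    by do 2 split=> //; move=> k l c; apply: b3; exists k, l.
- exists 1; rewrite /alternating (pow2_S H) (pow2_0 H); split; first arith.
  split; first arith.
  split=> [x /(not_lt_zero (RCA0_basic H)) //|k l [x [/(not_lt_zero (RCA0_basic H)) //]]].
- move=> n [s [sn /(alternating_extend sn) [i [i2 hi]]]]; exists (2 * s + i); split=> //.
  by rewrite (pow2_S H); arith.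
Qed.

(** Only direct neighbors are inspected, unlike in [alternating], so this is decidable and the
    strings that avoid it form a set of the model. *)
Definition improper s : Prop := exists x, x < s /\ exists y, y < s /\ exists i, i < 2 /\
  (bit s x i /\ bit s y i /\ inG x /\ inG y /\ x = y ⊕ b).

Lemma bit_lt s n x i : s < pow2 (n + 1) -> bit s x i -> x < n.
Proof.
move=> sn [u [_ [k [_ [r [rk [e [xu ux]]]]]]]].
have [nx|//] := le_or_lt H n x; exfalso.
have h : pow2 (n + 1) <= pow2 (x + 1) by apply: (pow2_le H); arith.
have := pow2_gt H k; move: h sn; rewrite e (pow2_S H x); narith.
Qed.

Lemma infinite_order_coloring : WKL M ->
  exists c, is_coloring G 2 c /\ forall x y, ~ monochromatic_solution G b c x y.
Proof.
move=> wkl.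
have [|T hT] := comprehension H (P := fun s => s <> 0 /\ ~ improper s).
  by rewrite /rel1 /improper; definable.
have treeT : is_binary_tree T.
  split=> [s /hT []//|s t s0 /(initial_segmentP H) [k [r [rk e]]] /hT [_ proper]].
  apply/hT; split=> // -[x [xs [y [ys [i [i2 [bx [by_ h]]]]]]]]; apply: proper.
  have st : s <= t by rewrite e; have := pow2_gt H k; narith.
  exists x; split; first arith.
  exists y; split; first arith.
  by exists i; split=> //; rewrite e; split; [|split=> //]; exact: bit_extend.
have infT : infinite T.
  move=> m; have [s [sm [ms [hs good]]]] := alternating_exists m.
  have lt : m < s by have := pow2_gt H m; arith.
  exists s; split=> //; apply/hT; split; first by move=> s0; move: lt; rewrite s0; arith.
  move=> [x [_ [y [_ [i [i2 [bx [by_ [Gx [Gy e]]]]]]]]]].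
  (* A pair [x = y + b] with equal colors is a conflict for the multiples 0 and 1. *)
  apply: (good 0 1); exists x; split; first exact: bit_lt sm bx.
  exists y; split; first exact: bit_lt sm by_.
  exists i; split=> //; exists i; split=> //; split; [split=> //; split=> //|do 2 split=> //].
    rewrite mult0 // -(m_add0 H 1) multS // mult0 // (gplusC H AG (gzero_in AG)) //.
    by rewrite !(gplus0 H AG).
  rewrite (_ : _ + _ = i + i + 1); last arith.
  exact: (odd_not_even H).
have [f [ff [g [[gf [g0 gS]] gT]]]] := wkl T treeT infT.
have [f1 [f2 f3]] := ff.
(* The path colors every number, whereas a coloring of [G] must have the carrier as its exact
   domain. *)
have [|c hc] := comprehension H (P := fun k => k ∈ f /\
    exists x, x < k + 1 /\ exists i, i < k + 1 /\ (k = pair x i /\ inG x)).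
  by rewrite /rel1; definable.
have maps_c x i : maps c x i <-> maps f x i /\ inG x.
  rewrite /maps hc; split=> [[xi [x' [_ [i' [_ [/(pair_inj H) [<- _] Gx]]]]]]//|[xi Gx]].
  split=> //; exists x; split; first by have := pair_ge_l H x i; arith.
  by exists i; split=> //; have := pair_ge_r H x i; arith.
exists c; split.
  split=> [k /hc [/f1 [x [i [_ [i2 ->]]]] [x' [_ [i' [_ [e Gx]]]]]]|].
    by have [-> _] := pair_inj H e; exists x', i.
  split=> [x i j /maps_c [xi _] /maps_c [xj _]|x Gx]; first exact: f2 xi xj.
  by have [//|i [i2 xi]] := f3 x; exists i; split=> //; apply/maps_c.
move=> x y [Gx [Gy [/(gdiffP H AG Gx Gy Gb) e [i [/maps_c [xi _] /maps_c [yi _]]]]]].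
have prefix n : exists s, maps g n s /\ (pow2 n <= s /\ s < pow2 (n + 1)) /\
    forall z, z < n -> forall j, j < 2 -> maps f z j -> bit s z j.
  move: n; apply: (induct1 H); first definable.
    exists 1; split=> //; rewrite (pow2_S H) (pow2_0 H); split; first by split; arith.
    by move=> z /(not_lt_zero (RCA0_basic H)).
  move=> n [s [ns [[s1 s2] hs]]]; have [//|j [j2 nj]] := f3 n.
  exists (2 * s + j); split; first exact: gS.
  have [_ j2'] : True /\ j < 2 by [].
  split; first by rewrite !(pow2_S H) in s2 *; split; arith.
  have -> : 2 * s + j = s * pow2 1 + j.
    by rewrite (pow2_1 H); arith.
  move=> z /(lt_succ (RCA0_basic H)) [zn|->] l l2 zl.
    apply: bit_extend => //; last exact: hs.
    by rewrite (pow2_1 H); arith.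
  rewrite (f2 _ _ _ zl nj) (_ : _ + _ = (s + s + j) * pow2 0 + 0).
    by apply: bit_intro => //; rewrite (pow2_0 H); arith.
  by rewrite (pow2_1 H) (pow2_0 H); arith.
(* A prefix of this length contains both positions, so a monochromatic pair would make it improper
   although it lies in the tree. *)
have [s [ns [[s1 s2] hs]]] := prefix (x + y + 1).
have [] := (hT s).1 (gT _ _ ns) => _; apply.
have lt := pow2_gt H (x + y + 1).
exists x; split; first arith.
exists y; split; first arith.
have i2 : i < 2.
  have [j [j2 xj]] := f3 x I; by rewrite (f2 _ _ _ xi xj).
exists i; split=> //; split; first by apply: hs => //; arith.
split; first by apply: hs => //; arith.
by do 2 split=> //; rewrite e; exact: gplusC.
Qed.
End InfiniteOrder.

(** * Choosing the number of colors *)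

Section ColoringOfWKL.
Variables (M : L2structure) (H : RCA0 M).
Implicit Types d h i j k l m n p q r s t u x y z : num M.

Definition color2 j : num M := if pselect (even j) then 0 else 1.

Definition color3 j : num M := if pselect (j = 0) then 2 else color2 j.

Lemma color2_even j : even j -> color2 j = 0.
Proof. by rewrite /color2; case: pselect. Qed.

Lemma color2_odd j : ~ even j -> color2 j = 1.
Proof. by rewrite /color2; case: pselect. Qed.

Lemma color2_lt j : color2 j < 2.
Proof. by have [e|e] := EM (even j); rewrite ?(color2_even e) ?(color2_odd e); arith. Qed.

Lemma color3_0 : color3 0 = 2.
Proof. by rewrite /color3; case: pselect. Qed.

Lemma color3_pos j : j <> 0 -> color3 j = color2 j.
Proof. by rewrite /color3; case: pselect. Qed.

Lemma rec1_color2 : rec1 color2.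
Proof.
apply: (@sigma1_ext _ (fun e => (even (e 1%N) /\ e 0%N = 0) \/ (~ even (e 1%N) /\ e 0%N = 1))).
  by move=> e /=; rewrite /color2; case: pselect => /= ?; tauto.
definable.
Qed.
Hint Resolve rec1_color2 : definability.

Lemma rec1_color3 : rec1 color3.
Proof.
apply: (@sigma1_ext _ (fun e => (e 1%N = 0 /\ e 0%N = 2) \/
  (~ e 1%N = 0 /\ e 0%N = color2 (e 1%N)))).
  by move=> e /=; rewrite /color3; case: pselect => /= ?; tauto.
definable.
Qed.

Lemma zero_neq_one : (0 : num M) <> 1. Proof. by arith. Qed.

Lemma odd1 : ~ even (1 : num M).
Proof. by have := @odd_not_even _ H 0; rewrite !(m_add0 H). Qed.

Lemma color2S j : color2 j <> color2 (j + 1).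
Proof.
have := even_add H j 1; have := odd1; have := zero_neq_one; have := nesym zero_neq_one.
have [e|e] := EM (even j); have [e'|e'] := EM (even (j + 1));
  by rewrite ?(color2_even e) ?(color2_even e') ?(color2_odd e) ?(color2_odd e'); tauto.
Qed.

Lemma coloring_of_WKL : WKL M -> coloring_principle M.
Proof.
move=> wkl G b AG Gb b0.
have e0 : even (0 : num M) by have := even_double H 0; rewrite (m_add0 H).
have col0 := color2_even e0.
have [[n [n0 nb]]|inf] := EM (exists n, 0 < n /\ mult G b n = gzero G); last first.
  have b_inf m : 0 < m -> mult G b m <> gzero G by move=> m0 e; apply: inf; exists m.
  exists 2; split; last exact: infinite_order_coloring.
  by left; split=> //; right=> m m0 /(multipleP H AG Gb) e; apply: (b_inf m).
have [||N [[N0 Nb] minN]] := least H (P := fun n => 0 < n /\ mult G b n = gzero G).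
- by rewrite /rel1; definable.
- by exists n.
have N_min m : 0 < m -> m < N -> mult G b m <> gzero G by move=> m0 /minN mN e; apply: mN.
have ordN : has_order G b N.
  split=> //; split; first exact/(multipleP H AG Gb).
  by move=> m m0 mN /(multipleP H AG Gb)/esym; exact: N_min.
have [[h Nh]|[h Nh]] := parity H N.
  exists 2; split.
    by left; split=> //; left; exists N, h; split=> //; arith.
  apply: (finite_order_coloring H AG Gb N0 Nb N_min rec1_color2) => [j|j _|j jN].
  - exact: color2_lt.
  - exact: color2S.
  - rewrite col0 color2_odd; first exact: nesym zero_neq_one.
    have : even (j + 1) by rewrite jN Nh; exact: even_double.
    by move/(even_add H); have := odd1; tauto.
exists 3; split; first by right; split=> //; exists N, h; split=> //; arith.
have succ_neq0 j : j + 1 <> 0 by exact: succ_neq_zero (RCA0_basic H) j.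
apply: (finite_order_coloring H AG Gb N0 Nb N_min rec1_color3) => [j|j _|j jN].
- have [->|j0] := EM (j = 0); first by rewrite color3_0; arith.
  by rewrite color3_pos //; have := color2_lt j; arith.
- rewrite (color3_pos (@succ_neq0 j)); have [->|j0] := EM (j = 0).
    by rewrite color3_0 => e; have := color2_lt (0 + 1); rewrite -e; exact: lt_irrefl.
  by rewrite color3_pos //; exact: color2S.
(* The cycle of length 1 has no proper coloring; it is excluded because order 1 would mean that [b]
   is zero. *)
- have j0 : j <> 0.
    move=> j0; apply: b0; rewrite -Nb -jN j0 multS // mult0 //.
    by rewrite (gplusC H AG (gzero_in AG)) // gplus0.
  rewrite color3_0 color3_pos // => e; have := color2_lt j.
  by rewrite e; exact: lt_irrefl.
Qed.
End ColoringOfWKL.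

(** * Weak König's lemma from colorings *)

(** Every number [w] codes an integer vector of finite support: [pos w i] and
    [neg w i] are read in unary from the finite set coded by [w], and the [i]-th
    entry is their difference. *)
Definition count (M : L2structure) (w i : num M) : num M :=
  least_number (fun v => ~ elem (pair i v) w).

Definition pos (M : L2structure) (w i : num M) : num M := count w (i + i).
Definition neg (M : L2structure) (w i : num M) : num M := count w (i + i + 1).

Section Vectors.
Variables (M : L2structure) (H : RCA0 M).
Implicit Types d h i j k l m n p q r s t u v w x y z : num M.

Lemma not_elem_count w i : ~ elem (pair i w) w.
Proof. by move=> /(elem_lt H); have := pair_ge_r H i w; arith. Qed.

Lemma rec2_count : rec2 (@count M).
Proof.
apply: (rec2_least H (P := fun w i v => ~ elem (pair i v) w)).
  by rewrite /rel3; definable.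
by move=> w i; exists w; exact: not_elem_count.
Qed.
Hint Resolve rec2_count : definability.

Lemma rec2_pos : rec2 (@pos M).
Proof. by rewrite /rec2 /pos; definable. Qed.

Lemma rec2_neg : rec2 (@neg M).
Proof. by rewrite /rec2 /neg; definable. Qed.
Hint Resolve rec2_pos rec2_neg : definability.

Lemma count_le w i : count w i <= w.
Proof.
have [||_ h] := least_numberP H (P := fun v => ~ elem (pair i v) w).
- by rewrite /rel1; definable.
- by exists w; exact: not_elem_count.
have [//|l] := le_or_lt H (count w i) w.
by case: (h _ l); exact: not_elem_count.
Qed.

Lemma count_gt w i : w <= i -> count w i = 0.
Proof.
move=> wi; apply: (least_number_eq H) => [/(elem_lt H)|k /(not_lt_zero (RCA0_basic H))//].
by have := pair_ge_l H i 0; arith.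
Qed.

Lemma pos_gt w i : w <= i -> pos w i = 0.
Proof. by move=> wi; apply: count_gt; arith. Qed.

Lemma neg_gt w i : w <= i -> neg w i = 0.
Proof. by move=> wi; apply: count_gt; arith. Qed.

Lemma pair_le i j k l : i <= k -> j <= l -> pair i j <= pair k l.
Proof.
have ex (a b : num M) : a <= b -> exists c, b = a + c.
  move=> ab; have [[u ->]|[u e]] := m_le_total H b a; first by exists u.
  by exists 0; arith.
move=> /ex [a ->] /ex [b ->]; rewrite /pair; narith.
Qed.

Lemma vector_code (a c : num M -> num M) m : rec1 a -> rec1 c ->
  (forall i, a i <= m /\ c i <= m) -> (forall i, m <= i -> a i = 0 /\ c i = 0) ->
  exists w, forall i, pos w i = a i /\ neg w i = c i.
Proof.
move=> ra rc am a0.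
(* Row [2i] holds the numbers below [a i] and row [2i+1] those below [c i]; the parity of the row
   keeps the two apart, and all pairs stay below the one with entries [2m+1] and [m]. *)
have [|w hw] := finite_set H (P := fun q => exists i, i <= q /\ exists v, v <= q /\
    ((q = pair (i + i) v /\ v < a i) \/ (q = pair (i + i + 1) v /\ v < c i)))
    (pair (m + m + 1) m + 1).
  by rewrite /rel1; definable.
exists w => i.
have im v : v < a i \/ v < c i -> i < m.
  move=> h; have [/a0 [ai ci]|//] := le_or_lt H m i.
  by case: h; rewrite ?ai ?ci => /(not_lt_zero (RCA0_basic H)).
have p1 : forall v, elem (pair (i + i) v) w <-> v < a i.
  move=> v; rewrite hw; split=> [[_ [j [_ [u [_ [[/(pair_inj H) [e ->]]|[/(pair_inj H) [e _]]]]]]]]|va].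
  - by rewrite (_ : j = i); arith.
  - by case: (even_odd H e).
  - have [ami _] := am i; have im' := im v (or_introl va).
    have pl : pair (i + i) v <= pair (m + m + 1) m by apply: pair_le; arith.
    split; first arith.
    exists i; split; first by have := pair_ge_l H (i + i) v; arith.
    by exists v; split; [exact: pair_ge_r | left].
have p2 : forall v, elem (pair (i + i + 1) v) w <-> v < c i.
  move=> v; rewrite hw; split=> [[_ [j [_ [u [_ [[/(pair_inj H) [e _]]|[/(pair_inj H) [e ->]]]]]]]]|va].
  - by case: (even_odd H (esym e)).
  - by rewrite (_ : j = i); arith.
  - have [_ ami] := am i; have im' := im v (or_intror va).
    have pl : pair (i + i + 1) v <= pair (m + m + 1) m by apply: pair_le; arith.
    split; first arith.
    exists i; split; first by have := pair_ge_l H (i + i + 1) v; arith.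
    by exists v; split; [exact: pair_ge_r | right].
split; apply: (least_number_eq H) => [|k]; rewrite ?p1 ?p2; try exact: lt_irrefl.
  by move=> h; apply.
by move=> h; apply.
Qed.

Definition coef w i : model_int H :=
  (of_nat (pos w i : model_nat H) - of_nat (neg w i : model_nat H))%R.

Lemma coef_gt w i : w <= i -> coef w i = 0%R.
Proof. by move=> wi; rewrite /coef pos_gt // neg_gt // subrr. Qed.

(** Negative parts are moved across the equation, as the model has no subtraction. A code [w] has no
    entries at indices from [w] on, so the bounds in this and the next two definitions lose
    nothing. *)
Definition is_vsum x y z : Prop := forall i, i < x + y + z ->
  pos z i + neg x i + neg y i = neg z i + pos x i + pos y i.

Definition is_vopp x y : Prop := forall i, i < x + y -> pos x i + pos y i = neg x i + neg y i.

Definition is_vsingle n j z : Prop := forall i, i < j + z + 1 ->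
  (i = j -> pos z i = neg z i + n) /\ (i <> j -> pos z i = neg z i).

Definition vadd x y : num M := least_number (is_vsum x y).
Definition vopp x : num M := least_number (is_vopp x).
Definition vsingle n j : num M := least_number (is_vsingle n j).

Lemma rel3_is_vsum : rel3 is_vsum.
Proof. by rewrite /rel3 /is_vsum; definable. Qed.
Lemma rel2_is_vopp : rel2 is_vopp.
Proof. by rewrite /rel2 /is_vopp; definable. Qed.
Lemma rel3_is_vsingle : rel3 is_vsingle.
Proof. by rewrite /rel3 /is_vsingle; definable. Qed.
Hint Resolve rel3_is_vsum rel2_is_vopp rel3_is_vsingle : definability.

Lemma is_vsum_ex x y : exists z, is_vsum x y z.
Proof.
have [||i|i|z hz] := @vector_code (fun i => pos x i + pos y i) (fun i => neg x i + neg y i) (x + y).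
- by rewrite /rec1; definable.
- by rewrite /rec1; definable.
- have := count_le x (i + i); have := count_le y (i + i).
  have := count_le x (i + i + 1); have := count_le y (i + i + 1).
  by rewrite /pos /neg; split; arith.
- move=> xyi; have xi : x <= i by arith.
  have yi : y <= i by arith.
  by rewrite !pos_gt ?neg_gt //; split; arith.
- by exists z => i _; have [-> ->] := hz i; arith.
Qed.

Lemma is_vopp_ex x : exists z, is_vopp x z.
Proof.
have [||i|i|z hz] := @vector_code (neg x) (pos x) x.
- by rewrite /rec1; definable.
- by rewrite /rec1; definable.
- by split; exact: count_le.
- by move=> xi; rewrite pos_gt // neg_gt.
- by exists z => i _; have [-> ->] := hz i; arith.
Qed.

Lemma is_vsingle_ex n j : exists z, is_vsingle n j z.
Proof.
pose a i := if pselect (i = j) then n else 0.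
have aj : a j = n by rewrite /a; case: pselect.
have ai i : i <> j -> a i = 0 by rewrite /a; case: pselect.
have [||i|i|z hz] := @vector_code a (fun _ => 0) (n + j + 1).
- apply: (@sigma1_ext _ (fun e => (e 1%N = j /\ e 0%N = n) \/ (~ e 1%N = j /\ e 0%N = 0))).
    move=> e; have [->|ne] := EM (e 1%N = j); first by rewrite aj; tauto.
    by rewrite ai //; tauto.
  by definable.
- by rewrite /rec1; definable.
- by have [->|/ai ->] := EM (i = j); rewrite ?aj; split; arith.
- by move=> h; rewrite ai // => e; move: h; rewrite e; arith.
- exists z => i _; have [-> ->] := hz i; split=> [->|/ai ->] //.
  by rewrite aj m_add0.
Qed.

Lemma coef_eqE x i : coef x i = 0%R <-> pos x i = neg x i.
Proof. by rewrite /coef; split=> [|->]; [|rewrite subrr] => // e; arith. Qed.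

Lemma coef_vadd x y i : coef (vadd x y) i = (coef x i + coef y i)%R.
Proof.
have [||h _] := least_numberP H (P := is_vsum x y); first by rewrite /rel1; definable.
  exact: is_vsum_ex.
have [l|l] := le_or_lt H (x + y + vadd x y) i; first by rewrite !coef_gt ?addr0 //; arith.
by have := h _ l; rewrite -/(vadd x y) /coef => e; arith.
Qed.

Lemma coef_vopp x i : coef (vopp x) i = (- coef x i)%R.
Proof.
have [||h _] := least_numberP H (P := is_vopp x); first by rewrite /rel1; definable.
  exact: is_vopp_ex.
have [l|l] := le_or_lt H (x + vopp x) i; first by rewrite !coef_gt ?oppr0 //; arith.
by have := h _ l; rewrite -/(vopp x) /coef => e; arith.
Qed.

Lemma coef_vsingle n j : coef (vsingle n j) j = of_nat (n : model_nat H) /\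
  forall i, i <> j -> coef (vsingle n j) i = 0%R.
Proof.
have [||h _] := least_numberP H (P := is_vsingle n j); first by rewrite /rel1; definable.
  exact: is_vsingle_ex.
split=> [|i ij].
  have [|e _] := h j; first by rewrite -/(vsingle n j); arith.
  by move: (e erefl); rewrite -/(vsingle n j) /coef => {}e; arith.
have [l|l] := le_or_lt H (vsingle n j) i; first by rewrite coef_gt.
have [|_ e] := h i; first by rewrite -/(vsingle n j); arith.
by move: (e ij); rewrite -/(vsingle n j) /coef => {}e; arith.
Qed.

Lemma rec2_vadd : rec2 vadd.
Proof. by apply: rec2_least => //; [exact: rel3_is_vsum | exact: is_vsum_ex]. Qed.

Lemma rec1_vopp : rec1 vopp.
Proof. by apply: rec1_least => //; [exact: rel2_is_vopp | exact: is_vopp_ex]. Qed.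

Lemma rec2_vsingle : rec2 vsingle.
Proof. by apply: rec2_least => //; [exact: rel3_is_vsingle | exact: is_vsingle_ex]. Qed.
End Vectors.
#[global] Hint Resolve rec2_pos rec2_neg rec2_vadd rec1_vopp rec2_vsingle : definability.

(** * The group whose relations are enumerated in stages *)

Section Quotient.
Variables (M : L2structure) (H : RCA0 M).
(** [act s i] is to mean that [i] is enumerated at stage [s], with [eps s] the parity to be
    recorded. Index 0 is reserved for [b]; a stage enumerates at most one index, and an index is
    enumerated at most once. *)
Variables (act : num M -> num M -> Prop) (eps : num M -> num M).
Hypotheses (rel_act : rel2 act) (rec_eps : rec1 eps).
Hypothesis act_le : forall s i, act s i -> i <= s.
Hypothesis act_pos : forall s i, act s i -> i <> 0.
Hypothesis act_fun : forall s i j, act s i -> act s j -> i = j.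
Hypothesis act_inj : forall s t i, act s i -> act t i -> s = t.
Hypothesis eps_lt : forall s, eps s < 2.
Implicit Types d h i j k l m n p q r s t u v w x y z : num M.
Local Notation "% x" := (of_nat (x : model_nat H)) (at level 2).
Local Notation coef := (coef H).

Lemma mul_le x y u v : x <= y -> u <= v -> x * u <= y * v.
Proof.
have ex (c d : num M) : c <= d -> exists e, d = c + e.
  move=> cd; have [[z dz]|[z ->]] := m_le_total H c d; last by exists z.
  by exists 0; arith.
by move=> /ex [a ->] /ex [b ->]; narith.
Qed.

(** [growth t] bounds 1, the value of [b], plus the sum of the weights of all stages before [t]. The
    final 1 of the recursion absorbs [eps t]. *)
Definition growth : num M -> num M :=
  primrec (fun _ => 1) (fun _ t v => v + (t + 1) * (v + v) + 1) 0.

(** The relation [x_i = weight t * b] is imposed when [i] is enumerated at stage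
    [t].  Any combination of [b] and the earlier weights with coefficients of
    absolute value at most [t] stays below [weight t], so a relation with
    coefficients at most [w] only involves stages before [w].  The parity of
    [weight t] is that of [eps t]. *)
Definition weight t : num M := (t + 1) * (growth t + growth t) + eps t.

Let rec_growth_base : rec1 (fun _ : num M => 1 : num M).
Proof. by rewrite /rec1; definable. Qed.

Let rec_growth_step : rec3 (fun _ t v => v + (t + 1) * (v + v) + 1).
Proof. by rewrite /rec3; definable. Qed.

Lemma rec1_growth : rec1 growth.
Proof.
have := rec2_primrec H rec_growth_base rec_growth_step.
by rewrite /rec1 /growth => ?; definable.
Qed.
Hint Resolve rec1_growth : definability.

Lemma rec1_weight : rec1 weight.
Proof. by rewrite /rec1 /weight; definable. Qed.
Hint Resolve rec1_weight : definability.

Lemma growth0 : growth 0 = 1.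
Proof. by rewrite /growth primrec0. Qed.

Lemma growthS t : growth (t + 1) = growth t + (t + 1) * (growth t + growth t) + 1.
Proof. by rewrite /growth primrecS. Qed.

Lemma growth_gt0 t : 0 < growth t.
Proof.
move: t; apply: (induct1 H); first definable.
  by rewrite growth0; arith.
by move=> t IH; rewrite growthS; narith.
Qed.

Definition at_stage (f : num M -> num M -> num M) w t : num M :=
  if pselect (exists i, act t i) is left h then f w (projT1 (cid h)) else 0.

Lemma at_stageP f w t i : act t i -> at_stage f w t = f w i.
Proof.
move=> ti; rewrite /at_stage; case: pselect => [h|[]]; last by exists i.
by case: cid => j tj /=; rewrite (act_fun tj ti).
Qed.

Lemma at_stage0 f w t : ~ (exists i, act t i) -> at_stage f w t = 0.
Proof. by rewrite /at_stage; case: pselect. Qed.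

Lemma rec2_at_stage f : rec2 f -> rec2 (at_stage f).
Proof.
move=> rf; apply: (@sigma1_ext _ (fun e =>
  (exists i, i <= e 2%N /\ (act (e 2%N) i /\ e 0%N = f (e 1%N) i)) \/
  ((forall i, i <= e 2%N -> ~ act (e 2%N) i) /\ e 0%N = 0))); last definable.
move=> e; have [[i ti]|no] := EM (exists i, act (e 2%N) i).
  rewrite (at_stageP _ _ ti); split=> [[[j [_ [tj ->]]]|[/(_ i (act_le ti))]]|->] //.
    by rewrite (act_fun tj ti).
  by left; exists i; split=> //; exact: act_le.
rewrite at_stage0 //; split=> [[[j [_ [tj _]]]|[]]|->] //; first by case: no; exists j.
by right; split=> // i _ ti; apply: no; exists i.
Qed.

(** The multiple of [b] obtained from the entry at 0 and from the entries enumerated before the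
    given stage, each counted with its weight. It is formed for positive and negative parts
    separately. *)
Definition partial_value (f : num M -> num M -> num M) : num M -> num M -> num M :=
  primrec (f^~ 0) (fun w t v => v + weight t * at_stage f w t).

Section PartialValue.
Variable f : num M -> num M -> num M.
Hypothesis rf : rec2 f.

Let rec_base : rec1 (f^~ 0).
Proof. by rewrite /rec1; definable. Qed.

Let rec_step : rec3 (fun w t v => v + weight t * at_stage f w t).
Proof. by have := rec2_at_stage rf => ?; rewrite /rec3; definable. Qed.

Lemma rec2_partial_value : rec2 (partial_value f).
Proof. exact: rec2_primrec. Qed.

Lemma partial_value0 w : partial_value f w 0 = f w 0.
Proof. by rewrite /partial_value primrec0. Qed.

Lemma partial_valueS w t :
  partial_value f w (t + 1) = partial_value f w t + weight t * at_stage f w t.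
Proof. by rewrite /partial_value primrecS. Qed.

Lemma partial_value_le w t : (forall i, f w i <= w) -> partial_value f w t <= w * growth t.
Proof.
move=> fw; have := rec2_partial_value => ?; move: t; apply: (induct1 H); first definable.
  by rewrite partial_value0 growth0; have := fw 0; narith.
move=> t IH; rewrite partial_valueS growthS.
have st : at_stage f w t <= w.
  have [[i ti]|no] := EM (exists i, act t i); first by rewrite (at_stageP _ _ ti).
  by rewrite at_stage0 //; arith.
have wt : weight t <= (t + 1) * (growth t + growth t) + 1.
  by rewrite /weight; have := eps_lt t; arith.
have := mul_le wt st; arith.
Qed.
End PartialValue.

Hint Resolve rec2_partial_value : definability.

Definition pvalue : num M -> num M -> num M := partial_value (@pos M).
Definition nvalue : num M -> num M -> num M := partial_value (@neg M).

Lemma rec2_pvalue : rec2 pvalue.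
Proof. by apply: rec2_partial_value; exact: rec2_pos. Qed.

Lemma rec2_nvalue : rec2 nvalue.
Proof. by apply: rec2_partial_value; exact: rec2_neg. Qed.
Hint Resolve rec2_pvalue rec2_nvalue : definability.

Lemma pvalue0 w : pvalue w 0 = pos w 0.
Proof. by rewrite /pvalue partial_value0 //; exact: rec2_pos. Qed.

Lemma nvalue0 w : nvalue w 0 = neg w 0.
Proof. by rewrite /nvalue partial_value0 //; exact: rec2_neg. Qed.

Lemma pvalueS w t : pvalue w (t + 1) = pvalue w t + weight t * at_stage (@pos M) w t.
Proof. by rewrite /pvalue partial_valueS //; exact: rec2_pos. Qed.

Lemma nvalueS w t : nvalue w (t + 1) = nvalue w t + weight t * at_stage (@neg M) w t.
Proof. by rewrite /nvalue partial_valueS //; exact: rec2_neg. Qed.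

Lemma value_sum x y z : (forall i, coef z i = coef x i + coef y i)%R -> forall t,
  pvalue z t + nvalue x t + nvalue y t = nvalue z t + pvalue x t + pvalue y t.
Proof.
move=> zxy; have e i : pos z i + neg x i + neg y i = neg z i + pos x i + pos y i.
  by have := zxy i; rewrite /coef; arith.
apply: (induct1 H); first definable.
  by rewrite !pvalue0 !nvalue0.
move=> t IH; rewrite !pvalueS !nvalueS.
have es : at_stage (@pos M) z t + at_stage (@neg M) x t + at_stage (@neg M) y t =
    at_stage (@neg M) z t + at_stage (@pos M) x t + at_stage (@pos M) y t.
  have [[i ti]|no] := EM (exists i, act t i); first by rewrite !(at_stageP _ _ ti).
  by rewrite !at_stage0.
by have := f_equal (fun v => weight t * v) es; arith.
Qed.

(** A stage whose index has entry zero adds the same amount to both parts, so the value remains the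
    entry at 0. *)
Lemma value_const w T : (forall t i, t < T -> act t i -> coef w i = 0%R) ->
  forall t, t <= T -> pvalue w t + neg w 0 = nvalue w t + pos w 0.
Proof.
move=> wT; apply: (induct1 H); first definable.
  by rewrite pvalue0 nvalue0; arith.
move=> t IH tT; rewrite pvalueS nvalueS.
have es : at_stage (@pos M) w t = at_stage (@neg M) w t.
  have [[i ti]|no] := EM (exists i, act t i); last by rewrite !at_stage0.
  by rewrite !(at_stageP _ _ ti); apply/(coef_eqE H)/(wT t) => //; arith.
have tT' : t <= T by arith.
by rewrite es; have := IH tT'; arith.
Qed.

(** All the indices other than 0 that occur in [w] are enumerated before stage
    [t], and replacing each [x_i] by its value yields 0. *)
Definition null_at w t : Prop :=
  (forall i, i < w -> i <> 0 -> pos w i <> neg w i -> exists s, s < t /\ act s i) /\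
  pvalue w t = nvalue w t.

Lemma rel2_null_at : rel2 null_at.
Proof. by rewrite /rel2 /null_at; definable. Qed.
Hint Resolve rel2_null_at : definability.

Lemma null_at_support w t i :
  null_at w t -> i <> 0 -> coef w i <> 0%R -> exists s, s < t /\ act s i.
Proof.
move=> [sw _] i0 wi; have [l|l] := le_or_lt H w i; first by case: wi; rewrite coef_gt.
by apply: sw => // /(coef_eqE H).
Qed.

(** A nonzero entry enumerated at stage [t] would also have been enumerated earlier, against
    [act_inj]; hence stage [t] changes both sides equally. *)
Lemma null_atS w t : null_at w t -> null_at w (t + 1).
Proof.
move=> n; have [sw e] := n; split=> [i iw i0 wi|].
  by have [s [st si]] := sw _ iw i0 wi; exists s; split=> //; arith.
rewrite pvalueS nvalueS e; congr (_ + _ * _).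
have [[i ti]|no] := EM (exists i, act t i); last by rewrite !at_stage0.
rewrite !(at_stageP _ _ ti); apply/(coef_eqE H); apply: contrapT => wi.
have [s [st si]] := null_at_support n (act_pos ti) wi.
by move: st; rewrite (act_inj si ti); exact: lt_irrefl.
Qed.

(** Both partial values are at most [w * growth t], which is below [weight t] when [w <= t]. So two
    multiples of [weight t] can balance them only if the multiples agree. *)
Lemma null_at_pred w t : w <= t -> null_at w (t + 1) -> null_at w t.
Proof.
move=> wt [sw]; rewrite pvalueS nvalueS => e.
have p_le := @partial_value_le _ (rec2_pos H) w t (fun i => count_le H w _).
have n_le := @partial_value_le _ (rec2_neg H) w t (fun i => count_le H w _).
rewrite -/pvalue -/nvalue in p_le n_le.
have big : w * growth t < weight t.
  have gg : growth t <= growth t by arith.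
  by rewrite /weight; have := mul_le wt gg; have := growth_gt0 t; narith.
have key : at_stage (@pos M) w t = at_stage (@neg M) w t.
  move: e p_le n_le big.
  move: (at_stage _ _ _) (at_stage _ _ _) (weight t) (pvalue w t) (nvalue w t) (w * growth t).
  move=> a c W P N B e PB NB BW.
  have [/(m_ltP H) [d ca]|[//|/(m_ltP H) [d ac]]] := lt_trichotomy H a c; exfalso.
    by move: e; rewrite ca; narith.
  by move: e; rewrite ac; narith.
split; last by move: e; rewrite key; arith.
move=> i iw i0 wi; have [s [st si]] := sw _ iw i0 wi; exists s; split=> //.
case/(lt_succ (RCA0_basic H)): st => // st; subst s; exfalso; apply: wi.
by move: key; rewrite !(at_stageP _ _ si).
Qed.

(** By the growth of the weights it suffices to look at stage [w]; this makes
    the relations of the group decidable. *)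
Definition null w : Prop := null_at w w.

Lemma rel1_null : rel1 null.
Proof. by rewrite /rel1 /null; definable. Qed.
Hint Resolve rel1_null : definability.

Lemma null_at_add w t d : null_at w t -> null_at w (t + d).
Proof.
move=> wt; move: d; apply: (induct1 H); first definable.
  by rewrite (add_zero (RCA0_basic H)).
by move=> d IH; rewrite (m_addA H); exact: null_atS.
Qed.

Lemma null_atP w t : null_at w t -> null w.
Proof.
have [[d td]|[d wd]] := m_le_total H t w; last first.
  by rewrite /null {3}wd; exact: null_at_add.
rewrite td; move: d {td}; apply: (induct1 H); first definable.
  by rewrite (add_zero (RCA0_basic H)).
move=> d IH; rewrite (m_addA H) => h; apply/IH/null_at_pred => //; arith.
Qed.

Lemma null_at_ge w t : null w -> w <= t -> null_at w t.
Proof.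
move=> nw wt; have [[d ->]|[d wd]] := m_le_total H t w; first exact: null_at_add.
by rewrite (_ : t = w) //; arith.
Qed.

Lemma null_sum x y z :
  (forall i, coef z i = coef x i + coef y i)%R -> null x -> null y -> null z.
Proof.
(* Stage [x + y] is late enough for both given relations; [null_atP] transports the result to the
   stage of [z]. *)
move=> zxy nx ny; apply: (@null_atP _ (x + y)).
have nx' : null_at x (x + y) by apply: null_at_ge => //; arith.
have ny' : null_at y (x + y) by apply: null_at_ge => //; arith.
split=> [i _ i0 zi|].
  have [xi|/(null_at_support nx' i0) //] := EM (coef x i = 0%R).
  apply: (null_at_support ny' i0) => yi; apply: zi; apply/(coef_eqE H).
  by rewrite zxy xi yi addr0.
have := value_sum zxy (x + y); case: nx' ny' => [_ ->] [_ ->]; arith.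
Qed.

Lemma null_at_zero w t : (forall i, coef w i = 0%R) -> null_at w t.
Proof.
move=> w0; rewrite -(m_add0 H t); apply: null_at_add; split=> [i _ _ wi|].
  by case: wi; apply/(coef_eqE H).
by rewrite pvalue0 nvalue0; apply/(coef_eqE H).
Qed.

Lemma coef_vsingle0 j i : coef (vsingle 0 j) i = 0%R.
Proof.
have [e0 e] := coef_vsingle H 0 j; have [->|/e //] := EM (i = j).
by rewrite e0 of_nat0.
Qed.

Lemma null_opp x z : (forall i, coef z i = - coef x i)%R -> null x -> null z.
Proof.
move=> zx nx; apply: (@null_atP _ x); split=> [i _ i0 zi|].
  apply: (null_at_support nx i0) => xi; apply: zi; apply/(coef_eqE H).
  by rewrite zx xi oppr0.
have [|_ e] := @null_at_zero (vsingle 0 0) x; first exact: coef_vsingle0.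
have sum0 i : (coef (vsingle 0 0) i = coef x i + coef z i)%R.
  by rewrite coef_vsingle0 zx subrr.
by have := value_sum sum0 x; rewrite e; case: nx => _ ->; arith.
Qed.

(** A vector has many codes, and being null depends only on its entries; closure properties stated
    for families of entries need no computation with codes. *)
Definition null_family (c : num M -> model_int H) : Prop :=
  exists w, (forall i, coef w i = c i) /\ null w.

Lemma null_family0 : null_family (fun _ => 0%R).
Proof.
exists (vsingle 0 0); split; first exact: coef_vsingle0.
by apply: null_at_zero; exact: coef_vsingle0.
Qed.

Lemma null_familyD c1 c2 c : null_family c1 -> null_family c2 ->
  (forall i, c i = c1 i + c2 i)%R -> null_family c.
Proof.
move=> [x [xc nx]] [y [yc ny]] e; exists (vadd x y); split=> [i|].
  by rewrite coef_vadd xc yc e.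
by apply: null_sum nx ny; exact: coef_vadd.
Qed.

Lemma null_familyN c1 c : null_family c1 -> (forall i, c i = - c1 i)%R -> null_family c.
Proof.
move=> [x [xc nx]] e; exists (vopp x); split=> [i|].
  by rewrite coef_vopp xc e.
by apply: null_opp nx; exact: coef_vopp.
Qed.

Lemma null_familyE w c : (forall i, coef w i = c i) -> null w <-> null_family c.
Proof.
move=> wc; split=> [nw|[x [xc nx]]]; first by exists w.
have [z [z0 nz]] := null_family0.
by apply: null_sum nx nz => i; rewrite z0 addr0 xc wc.
Qed.

Definition equiv x y : Prop := null (vadd x (vopp y)).

Lemma rel2_equiv : rel2 equiv.
Proof. by rewrite /rel2 /equiv; definable. Qed.
Hint Resolve rel2_equiv : definability.

Lemma equivP x y : equiv x y <-> null_family (fun i => coef x i - coef y i)%R.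
Proof. by apply: null_familyE => i; rewrite coef_vadd coef_vopp. Qed.

Lemma equiv_refl x : equiv x x.
Proof.
by apply/equivP; apply: (null_familyD null_family0 null_family0) => i; rewrite addr0 subrr.
Qed.

Lemma equiv_sym x y : equiv x y -> equiv y x.
Proof. by move=> /equivP h; apply/equivP; apply: (null_familyN h) => i /=; rewrite [RHS]opprB. Qed.

Lemma equiv_trans x y z : equiv x y -> equiv y z -> equiv x z.
Proof.
by move=> /equivP h /equivP h'; apply/equivP; apply: (null_familyD h h') => i /=; rewrite addrA subrK.
Qed.

(** Equality in a group of the model is equality of numbers, so the least code of each class
    represents it. *)
Definition canon x : num M := least_number (equiv x).

Lemma rec1_canon : rec1 canon.
Proof.
apply: (rec1_least H rel2_equiv) => x.
by exists x; exact: equiv_refl.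
Qed.
Hint Resolve rec1_canon : definability.

Lemma equiv_canon x : equiv x (canon x).
Proof.
have [||h _] := least_numberP H (P := equiv x); last exact: h.
  by rewrite /rel1; definable.
by exists x; exact: equiv_refl.
Qed.

Lemma canon_eq x y : equiv x y <-> canon x = canon y.
Proof.
split=> [xy|e]; last first.
  by apply: equiv_trans (equiv_canon x) _; rewrite e; exact/equiv_sym/equiv_canon.
have [||_ h] := least_numberP H (P := equiv x); first by rewrite /rel1; definable.
  by exists x; exact: equiv_refl.
apply/esym/(least_number_eq H) => [|k kx yk].
  exact: equiv_trans (equiv_sym xy) (equiv_canon x).
by apply: (h k kx); exact: equiv_trans xy yk.
Qed.

Lemma canonK x : canon (canon x) = canon x.
Proof. by apply/esym/canon_eq/equiv_canon. Qed.

Lemma equiv_vadd x x' y y' : equiv x x' -> equiv y y' -> equiv (vadd x y) (vadd x' y').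
Proof.
move=> /equivP h /equivP h'; apply/equivP; apply: (null_familyD h h') => i /=.
by rewrite !coef_vadd; ring.
Qed.

Lemma equiv_coef x y : (forall i, coef x i = coef y i) -> equiv x y.
Proof.
move=> xy; apply/equivP; apply: (null_familyD null_family0 null_family0) => i /=.
by rewrite addr0 xy subrr.
Qed.

Definition vzero : num M := canon (vsingle 0 0).

Lemma quotient_group : exists G : group_data M, [/\ is_abelian_group G,
  forall x, in_group G x <-> canon x = x,
  forall x y z, gsum G x y z <-> [/\ canon x = x, canon y = y & z = canon (vadd x y)] &
  gzero G = vzero].
Proof.
have [|C hC] := comprehension H (P := fun x => canon x = x); first by rewrite /rel1; definable.
have [|A hA] := comprehension H (P := fun q => exists x, x <= q /\ exists y, y <= q /\
    (canon x = x /\ canon y = y /\ q = pair (pair x y) (canon (vadd x y)))).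
  by rewrite /rel1; definable.
have rel_canon : rel1 (fun x => canon x = x) by rewrite /rel1; definable.
have rec_opp : rec1 (fun x => canon (vopp x)) by rewrite /rec1; definable.
have [O [O1 O2]] := graph_set H rel_canon rec_opp.
pose G := {| carrier := C; gadd := A; gopp := O; gzero := vzero |}.
have inG x : in_group G x <-> canon x = x by exact: hC.
have sumG x y z : gsum G x y z <-> [/\ canon x = x, canon y = y & z = canon (vadd x y)].
  rewrite /gsum /maps /= hA; split=> [[a [_ [c [_ [ca [cc /(pair_inj H) [/(pair_inj H) [-> ->] ->]]]]]]]|[cx cy ->]] //.
  have h1 := pair_ge_l H (pair x y) (canon (vadd x y)).
  have h2 := pair_ge_l H x y; have h3 := pair_ge_r H x y.
  exists x; split; first arith.
  by exists y; split; first arith.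
have optG x : canon x = x -> canon (canon (vopp x)) = canon (vopp x) by rewrite canonK.
exists G; split=> //; split.
- split=> [q /hA [x [_ [y [_ [cx [cy ->]]]]]]|].
    exists (pair x y), (canon (vadd x y)); split; first by exists x, y; rewrite !inG.
    by rewrite inG canonK.
  split=> [p z z'|p [x [y [/inG cx [/inG cy ->]]]]]; last first.
    exists (canon (vadd x y)); rewrite inG canonK; split=> //.
    by apply/(sumG x y).
  rewrite /maps /= !hA => -[x [_ [y [_ [_ [_ /(pair_inj H) [-> ->]]]]]]].
  by move=> [x' [_ [y' [_ [_ [_ /(pair_inj H) [/(pair_inj H) [-> ->] ->]]]]]]].
- split=> [k /O1 [x [cx ->]]|]; first by exists x, (canon (vopp x)); rewrite !inG canonK.
  split=> [i j j' /O2 [_ ->] /O2 [_ ->] //|i /inG ci].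
  by exists (canon (vopp i)); rewrite inG canonK; split=> //; apply/O2.
- by rewrite inG /= canonK.
- move=> x y z u v w /sumG [cx cy ->] /sumG [_ cz ->] /sumG [_ _ ->]; apply/sumG.
  split=> //; first by rewrite canonK.
  apply/canon_eq; apply: equiv_trans (equiv_vadd (equiv_sym (equiv_canon _)) (equiv_refl z)) _.
  apply: equiv_trans (equiv_vadd (equiv_refl x) (equiv_canon _)).
  by apply: equiv_coef => i /=; rewrite !coef_vadd; ring.
- move=> x y z /sumG [cx cy ->]; apply/sumG; split=> //; apply/canon_eq/equiv_coef => i.
  by rewrite !coef_vadd; ring.
- move=> x /inG cx; apply/sumG; split=> //; first by rewrite /= canonK.
  rewrite -{1}cx; apply/canon_eq.
  apply: equiv_trans (equiv_vadd (equiv_refl x) (equiv_canon _)).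
  by apply: equiv_coef => i /=; rewrite coef_vadd coef_vsingle0 addr0.
- move=> x y /O2 [cx ->]; apply/sumG; split=> //; first by rewrite canonK.
  apply/canon_eq; apply: equiv_trans (equiv_vadd (equiv_refl x) (equiv_canon _)).
  by apply: equiv_coef => i /=; rewrite coef_vadd coef_vopp coef_vsingle0 subrr.
Qed.
(** This is why [b] has infinite order: no stage contributes to a vector supported at 0, so the
    value of [n b] is [n]. *)
Lemma vsingle_inj n : equiv (vsingle n 0) (vsingle 0 0) -> n = 0.
Proof.
move=> /equivP [w [wc nw]]; have [e0 e] := coef_vsingle H n 0.
have w0 i : i <> 0 -> coef w i = 0%R.
  by move=> i0; rewrite wc e // coef_vsingle0 subrr.
have := @value_const w w (fun t i _ ti => w0 i (act_pos ti)) w.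
case: nw => _ ->; have : coef w 0 = of_nat (n : model_nat H).
  by rewrite wc e0 coef_vsingle0 subr0.
by rewrite /coef; have : w <= w by [arith]; move=> ww ? /(_ ww); arith.
Qed.

(** Up to stage [s] the vector [x_i - weight s * b] has value [- weight s], and stage [s] adds
    [weight s]; so it is null at stage [s + 1]. *)
Lemma equiv_enumerated s i : act s i -> equiv (vsingle 1 i) (vsingle (weight s) 0).
Proof.
move=> si; have i0 := act_pos si.
have [e1 e1'] := coef_vsingle H 1 i; have [ew ew'] := coef_vsingle H (weight s) 0.
rewrite /equiv; set w := vadd _ _.
have wi : coef w i = 1%R by rewrite coef_vadd coef_vopp e1 ew' // oppr0 addr0 of_nat1.
have w0 : coef w 0 = (- of_nat (weight s : model_nat H))%R.
  by rewrite coef_vadd coef_vopp ew e1' ?add0r //; exact: nesym.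
have wj j : j <> 0 -> j <> i -> coef w j = 0%R.
  by move=> j0 ji; rewrite coef_vadd coef_vopp e1' // ew' // oppr0 addr0.
clearbody w; have early t j : t < s -> act t j -> coef w j = 0%R.
  move=> ts tj; apply: wj; first exact: act_pos tj.
  by move=> ji; move: tj ts; rewrite ji => ti; rewrite (act_inj ti si); exact: lt_irrefl.
apply: (@null_atP _ (s + 1)); split=> [j _ j0 nj|].
  exists s; split; first arith.
  have [->//|ji] := EM (j = i); case: nj; exact/(coef_eqE H)/wj.
have ss : s <= s by arith.
have := value_const early ss; rewrite pvalueS nvalueS !(at_stageP _ _ si).
move: wi w0; rewrite /coef => wi w0 val.
have wi' : pos w i = neg w i + 1 by arith.
by rewrite wi'; move: w0 val; move: (weight s) => W; arith.
Qed.

Lemma separation : coloring_principle M ->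
  exists S : sets M, forall s i, act s i -> (i ∈ S <-> eps s = 1).
Proof.
move=> principle; have [G [AG inG sumG zeroG]] := quotient_group.
pose b := canon (vsingle 1 0).
have Gb : in_group G b by rewrite inG canonK.
have vsingleS n : equiv (vadd (vsingle n 0) (vsingle 1 0)) (vsingle (n + 1) 0).
  apply: equiv_coef => i; rewrite coef_vadd.
  have [en en'] := coef_vsingle H n 0; have [e1 e1'] := coef_vsingle H 1 0.
  have [eS eS'] := coef_vsingle H (n + 1) 0.
  have [->|i0] := EM (i = 0); last by rewrite en' // e1' // eS' // addr0.
  by rewrite en e1 eS intD.
have multE n : mult G b n = canon (vsingle n 0).
  have rG := rec1_mult H AG b; move: n; apply: (induct1 H); first definable.
    by rewrite mult0.
  move=> n IH; rewrite multS // IH.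
  have cn : in_group G (canon (vsingle n 0)) by rewrite inG canonK.
  have /sumG [_ _ ->] := gplusP AG cn Gb.
  apply/canon_eq; apply: equiv_trans (vsingleS n).
  by apply: equiv_vadd; apply/equiv_sym/equiv_canon.
have b_infinite n : mult G b n = gzero G -> n = 0.
  by rewrite multE zeroG => /canon_eq/vsingle_inj.
have b0 : b <> gzero G.
  move=> e; have : (1 : num M) = 0; last by arith.
  apply: b_infinite; rewrite -(m_add0 H 1) multS // mult0 //.
  by rewrite (gplusC H AG (gzero_in AG)) // gplus0 // zeroG -e.
have [k [colors [c [col mono]]]] := principle G b AG Gb b0.
(* An odd order is impossible, since no positive multiple of [b] vanishes. *)
have k2 : k = 2.
  case: colors => [[]//|[[n [_ [[n0 [/(multipleP H AG Gb)/esym/b_infinite nz _]] _]]] _]].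
  by move: n0; rewrite nz; arith.
subst k; have [c1 [c2 c3]] := col.
have [i0 [i02 mi0]] := c3 _ (gzero_in AG).
have bits (i j l : num M) : i < 2 -> j < 2 -> l < 2 -> i <> j -> j <> l -> i = l.
  move=> /(bit_cases H) [->|->] /(bit_cases H) [->|->] /(bit_cases H) [->|->] //.
have rmult := rec1_mult H AG b.
have colorE n : even n <-> maps c (mult G b n) i0.
  have := rel1_even H => re.
  move: n; apply: (induct1 H); first definable.
    rewrite mult0 //; split=> // _; have := even_double H 0; by rewrite (m_add0 H).
  move=> n IH; have Gn := mult_in H AG Gb n; have GS := mult_in H AG Gb (n + 1).
  have [i [i2 ci]] := c3 _ Gn; have [j [j2 cj]] := c3 _ GS.
  have ij : i <> j.
    move=> ij; apply: (mono (mult G b (n + 1)) (mult G b n)).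
    do 2 split=> //; split; last by exists i; split=> //; rewrite ij.
    by apply/(gdiffP H AG) => //; rewrite multS //; exact: gplusC.
  have ii : maps c (mult G b n) i0 <-> i = i0.
    by split=> [h|<- //]; exact: c2 ci h.
  have ji : maps c (mult G b (n + 1)) i0 <-> j = i0.
    by split=> [h|<- //]; exact: c2 cj h.
  rewrite ji even_add // IH ii; have := odd1 H.
  have [e|ne] := EM (i = i0); first by rewrite -e; have := nesym ij; tauto.
  have -> : j = i0 by apply: (bits j i i0) => //; exact: nesym.
  by tauto.
have rx : rec1 (fun i => canon (vsingle 1 i)) by rewrite /rec1; definable.
have [|S hS] := comprehension H (P := fun i => ~ maps c (canon (vsingle 1 i)) i0).
  by rewrite /rel1; definable.
exists S => s i si; rewrite hS.
have -> : canon (vsingle 1 i) = mult G b (weight s).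
  by rewrite multE; apply/canon_eq/equiv_enumerated.
rewrite -colorE /weight; have [e|e] := bit_cases H (eps_lt s); rewrite e.
  split=> [[]|]; last by move/(zero_neq_one H).
  apply/(evenP H); exists ((s + 1) * growth s); arith.
split=> // _; rewrite (_ : _ + 1 = (s + 1) * growth s + (s + 1) * growth s + 1); last arith.
exact: odd_not_even.
Qed.
End Quotient.

(** * From separation to a path through the tree *)

Section Tree.
Variables (M : L2structure) (H : RCA0 M) (T : sets M).
Hypotheses (tree : is_binary_tree T) (inf : infinite T).
Implicit Types h i j k l m n r s t u v x y z : num M.

Definition alive s k : Prop := exists r, r < pow2 k /\ s * pow2 k + r ∈ T.

Lemma rel2_alive : rel2 alive.
Proof. by rewrite /rel2 /alive; definable. Qed.
Hint Resolve rel2_alive : definability.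

Lemma alive_pred s k : s <> 0 -> alive s (k + 1) -> alive s k.
Proof.
move=> s0 [r [rk rT]]; have [_ prefix] := tree; have k0 := pow2_gt H k.
have [x [x2 [h rh]]] : exists x, x < 2 /\ exists h, r = h + h + x.
  by have [[h rh]|[h rh]] := parity H r; [exists 0|exists 1]; (split; [arith | exists h; arith]).
exists h; split.
  have [l|//] := le_or_lt H (pow2 k) h; exfalso.
  by move: rk; rewrite pow2_S // rh; arith.
apply: (prefix _ (s * pow2 (k + 1) + r)) => //.
  by move: s0; have [//|[u ->] _] := m_zero_or_succ H s; rewrite /is_string; narith.
apply/(initial_segmentP H); exists 1, x; rewrite (pow2_1 H); split=> //.
by rewrite pow2_S // rh; narith.
Qed.

Lemma alive_le s k l : s <> 0 -> l <= k -> alive s k -> alive s l.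
Proof.
move=> s0 lk; have [[d ->]|[d ld]] := m_le_total H k l.
  move: d; apply: (induct1 H); first definable.
    by rewrite (add_zero (RCA0_basic H)).
  by move=> d IH; rewrite (m_addA H) => /(alive_pred s0)/IH.
by rewrite (_ : l = k) //; arith.
Qed.

Lemma alive_child s k : alive s (k + 1) -> alive (2 * s) k \/ alive (2 * s + 1) k.
Proof.
move=> [r [rk rT]]; have [l|l] := le_or_lt H (pow2 k) r; [right|left].
  have [[r' rr]|[d kr]] := m_le_total H r (pow2 k).
    exists r'; split; first by move: rk; rewrite pow2_S // rr; arith.
    by rewrite (_ : _ + r' = s * pow2 (k + 1) + r) // pow2_S // rr; narith.
  exists 0; split; first by have := pow2_gt H k; arith.
  by rewrite (_ : _ + 0 = s * pow2 (k + 1) + r) // pow2_S //; narith.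
exists r; split=> //.
by rewrite (_ : _ + r = s * pow2 (k + 1) + r) // pow2_S //; narith.
Qed.

(** A code above [2^k] belongs to a string of length at least [k], so unbounded codes in [T] mean
    strings of every length. *)
Lemma alive_root k : alive 1 k.
Proof.
have [n [kn nT]] := inf (pow2 k); have [strings _] := tree.
have [l [r [rl nl]]] := string_length H (strings _ nT).
apply: (@alive_le _ l); first by arith.
  have [//|lk] := le_or_lt H k l; have : pow2 (l + 1) <= pow2 k by apply: pow2_le => //; arith.
  by rewrite pow2_S //; arith.
by exists r; rewrite m_mul1 // -nl.
Qed.

(** If both children die at the same height, [s] is never enumerated; this does no harm, as [s] then
    has no extensions beyond that height. *)
Definition splits s k : Prop := alive (2 * s) k <-> ~ alive (2 * s + 1) k.

(** The string [s] is enumerated at the stage that records the first height at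
    which exactly one of the two subtrees above [s] has died out. *)
Definition stage q s : Prop := exists k, k <= q /\
  (q = pair s k /\ s <> 0 /\ splits s k /\ forall l, l < k -> ~ splits s l).

Definition left_dies q : Prop := exists s, s <= q /\ exists k, k <= q /\
  (q = pair s k /\ ~ alive (2 * s) k).

Definition dead_side q : num M := if pselect (left_dies q) then 1 else 0.

Lemma rel2_splits : rel2 splits.
Proof. by rewrite /rel2 /splits; definable. Qed.
Hint Resolve rel2_splits : definability.

Lemma rel2_stage : rel2 stage.
Proof. by rewrite /rel2 /stage; definable. Qed.

Lemma dead_side1 q : dead_side q = 1 <-> left_dies q.
Proof.
by rewrite /dead_side; case: pselect => h /=; split=> // /(zero_neq_one H).
Qed.

Lemma rec1_dead_side : rec1 dead_side.
Proof.
apply: (@sigma1_ext _ (fun e => (left_dies (e 1%N) /\ e 0%N = 1) \/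
  (~ left_dies (e 1%N) /\ e 0%N = 0))).
  by move=> e /=; rewrite /dead_side; case: pselect => /= ?; tauto.
rewrite /left_dies; definable.
Qed.

(** If the chosen child were dead at height [k], the other one would be alive there, so [s] was
    enumerated at a first splitting height [k0 <= k]. The other child is alive at [k0] too, so the
    chosen side is the one recorded as dead, which [S] avoids. *)
Lemma path_step (S : sets M) s i : (forall q s, stage q s -> (s ∈ S <-> dead_side q = 1)) ->
  s <> 0 -> (s ∈ S /\ i = 1) \/ (~ s ∈ S /\ i = 0) ->
  (forall k, alive s k) -> forall k, alive (2 * s + i) k.
Proof.
move=> hS s0 hi sA k; apply: contrapT => dead.
have sN0 : 2 * s <> 0 by move: s0; have [//|[u ->] _] := m_zero_or_succ H s; narith.
have sN1 : 2 * s + 1 <> 0 by narith.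
have sk : splits s k.
  have := alive_child (sA (k + 1)); rewrite /splits.
  case: hi => -[_ ie]; move: dead; rewrite ie; first by tauto.
  by rewrite (add_zero (RCA0_basic H)); tauto.
have [||k0 [sk0 hk0]] := least H (P := splits s).
- by rewrite /rel1; definable.
- by exists k.
have k0k : k0 <= k by have [//|l] := le_or_lt H k0 k; case: (hk0 _ l).
have st : stage (pair s k0) s.
  by exists k0; split; [exact: pair_ge_r | split].
have := hS _ _ st; rewrite dead_side1 => hl.
have left : left_dies (pair s k0) <-> ~ alive (2 * s) k0.
  split=> [[s' [_ [k' [_ [/(pair_inj H) [-> ->]]]]]] //|h].
  exists s; split; first exact: pair_ge_l.
  by exists k0; split; first exact: pair_ge_r.
have down0 := alive_le sN0 k0k; have down1 := alive_le sN1 k0k.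
move: sk sk0; rewrite /splits.
case: hi => -[hs ie]; move: dead; rewrite ie; first by tauto.
by rewrite (add_zero (RCA0_basic H)); tauto.
Qed.

Lemma path_of_coloring : coloring_principle M -> exists f, is_path T f.
Proof.
move=> principle.
have stage_le q s : stage q s -> s <= q by move=> [k [_ [-> _]]]; exact: pair_ge_l.
have stage_pos q s : stage q s -> s <> 0 by move=> [k [_ [_ []]]].
have stage_fun q s t : stage q s -> stage q t -> s = t.
  by move=> [k [_ [-> _]]] [l [_ [/(pair_inj H) [-> _]]]].
have stage_inj p q s : stage p s -> stage q s -> p = q.
  move=> [k [_ [-> [_ [ks hk]]]]] [l [_ [-> [_ [ls hl]]]]].
  by have [/hl//|[->//|/hk//]] := lt_trichotomy H k l.
have side_lt q : dead_side q < 2 by rewrite /dead_side; case: pselect => /= _; arith.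
have [S hS] := separation H rel2_stage rec1_dead_side stage_le stage_pos stage_fun stage_inj
  side_lt principle.
pose bit s : num M := if pselect (s ∈ S) then 1 else 0.
have bitP s : (s ∈ S /\ bit s = 1) \/ (~ s ∈ S /\ bit s = 0).
  by rewrite /bit; case: pselect => /=; tauto.
have rbit : rec1 bit.
  apply: (@sigma1_ext _ (fun e => (e 1%N ∈ S /\ e 0%N = 1) \/ (~ e 1%N ∈ S /\ e 0%N = 0))).
    by move=> e /=; rewrite /bit; case: pselect => /= ?; tauto.
  definable.
pose g := primrec (fun _ => 1) (fun _ _ v => 2 * v + bit v) 0.
have r1 : rec1 (fun _ : num M => 1 : num M) by rewrite /rec1; definable.
have r3 : rec3 (fun _ _ v => 2 * v + bit v) by rewrite /rec3; definable.
have g0 : g 0 = 1 by rewrite /g primrec0.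
have gS n : g (n + 1) = 2 * g n + bit (g n) by rewrite /g primrecS.
have rg : rec1 g.
  by have := rec2_primrec H r1 r3; rewrite /rec1 /g => ?; definable.
(* Being alive at all heights is a Pi1 property, so Pi1 induction carries it along the path. *)
have galive n : g n <> 0 /\ forall k, alive (g n) k.
  move: n; apply: (pi1_induction H).
  - apply: (@sigma1_ext _ (fun e => g (e 0%N) = 0 \/
      exists k, ~ alive (g (e 0%N)) k)); last definable.
    move=> e; split=> [[gz [//]|[k na] [_ /(_ k)//]]|h].
    apply: contrapT; rewrite not_orE => -[gz na]; apply: h; split=> // k.
    by apply: contrapT => nk; apply: na; exists k.
  - rewrite g0; split; last exact: alive_root.
    by arith.
  - move=> n [gn0 ga]; rewrite gS; split; last exact: path_step (bitP _) ga.
    by move: gn0; have [//|[u ->] _] := m_zero_or_succ H (g n); narith.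
have gT n : g n ∈ T.
  have [_ /(_ 0) [r]] := galive n; rewrite (pow2_0 H) => -[r1' rT].
  by rewrite (_ : g n = g n * 1 + r) //; arith.
have rf : rec1 (fun n => bit (g n)) by rewrite /rec1; definable.
have all : rel1 (numbers M) by exact: delta1_const.
have [F [F1 F2]] := graph_set H all rf.
have [J [J1 J2]] := graph_set H all rg.
exists F; split.
  apply: graph_function F1 F2 _ => n _; rewrite /below.
  by have [[_ ->]|[_ ->]] := bitP (g n); arith.
exists J; split; last by move=> n s /J2 [_ ->].
split; first exact: (graph_function J1 J2).
split; first by apply/J2; rewrite g0.
by move=> n s i /J2 [_ ->] /F2 [_ ->]; apply/J2; rewrite gS.
Qed.
End Tree.

Theorem theorem4p1 :
  forall M : L2structure, RCA0 M -> (WKL0 M <-> coloring_principle M).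
Proof.
move=> M H; split=> [[_ wkl]|principle]; first exact: coloring_of_WKL.
by split=> // T tree inf; exact: path_of_coloring.
Qed.
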